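(* For all positive integers $k,m$, $$\begin{aligned}\mathrm{DFT}_{2km}={}&L_k^{2km}\,(I_{2m}\otimes\mathrm{DFT}_k)\,X^{2km}_m\,L_{2m}^{2km}\,(I_m\oplus Z_m^{-1}\oplus I_{2(k-1)m})\,D^{2km}_m\\ &\times\Big(\mathrm{DCT\text{-}1}_{m+1}\oplus\mathrm{DST\text{-}1}_{m-1}\oplus \big(I_{k-1}\otimes(\mathrm{DCT\text{-}2}_m\oplus\mathrm{DST\text{-}2}_m)\big)\Big)\,B^{2km}_m,\end{aligned}$$ where $D^{2km}_m$ is the diagonal matrix, and $B^{2km}_m$, $X^{2km}_m$ are the matrices with at most two non-zero entries in each row, that are specified in the context. Moreover, in the algebra $\mathcal{A}=\mathbb{C}[x]/(x^{2km}-1)$ with subalgebra $\mathcal{B}=\langle (x^k+x^{-k})/2\rangle$, the polynomials $t_0(x)=1$, $t_1(x)=(x^k-x^{-k})/2$, $t_{2j}(x)=x^j(x^k+1)/2$ and $t_{2j+1}(x)=x^j(x^k-1)/2$ for $1\le j<k$ form a transversal of $\mathcal{B}$ in $\mathcal{A}$ (the one underlying this factorization), i.e. $\mathcal{A}=\bigoplus_{\ell=0}^{2k-1}t_\ell(x)\mathcal{B}$ as vector spaces.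
   Context: All row/column indices start at $0$; matrices of size $0$ are empty. $\oplus$ is the block-diagonal direct sum, $\otimes$ the Kronecker product, and $\oslash_{j=a}^{b}A_j$ is the block anti-diagonal matrix with $A_a$ in the top-right corner, continuing down to $A_b$ in the bottom-left corner. $\omega_n=e^{-2\pi i/n}$. Transforms (unscaled), with $a$ the row index and $\ell$ the column index: $\mathrm{DFT}_n=[\omega_n^{a\ell}]_{0\le a,\ell<n}$; $\mathrm{DCT\text{-}1}_{m+1}=[\cos\frac{a\ell\pi}{m}]_{0\le a,\ell<m+1}$; $\mathrm{DST\text{-}1}_{m-1}=[\sin\frac{(a+1)(\ell+1)\pi}{m}]_{0\le a,\ell<m-1}$; $\mathrm{DCT\text{-}2}_m=[\cos\frac{a(\ell+1/2)\pi}{m}]_{0\le a,\ell<m}$; $\mathrm{DST\text{-}2}_m=[\sin\frac{(a+1)(\ell+1/2)\pi}{m}]_{0\le a,\ell<m}$. $I_n$ is the identity; $J_n$ has $(a,n-1-a)$ entries $1$ and all others $0$; $Z_n=\begin{pmatrix} & 1 \\ I_{n-1} & \end{pmatrix}$ is the circular shift matrix ($Z_1=(1)$). For $k\mid n$, $L_k^n$ is the $n\times n$ permutation matrix selecting elements at stride $k$: with $n=km'$, row $jm'+i$ has its $1$ in column $ik+j$, for $0\le i<m'$, $0\le j<k$. Matrix $B^{2km}_m$: $$B^{2km}_m=\left(\begin{pmatrix}1\\ &I_{m-1}&&J_{m-1}\\ &&1\\ &I_{m-1}&&-J_{m-1}\end{pmatrix}\oplus I_{k-1}\otimes\begin{pmatrix}1&1\\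 &&I_{m-1}&J_{m-1}\\ -1&1\\ &&I_{m-1}&-J_{m-1}\end{pmatrix}\right)L_k^{2km}.$$ Matrix $X^{2km}_m$ (block columns of widths $k,(m-1)k,(m-1)k,k$, block rows of heights $k,(m-1)k,k,(m-1)k$): $$X^{2km}_m=\begin{pmatrix}I_k\\ &\oplus_{j=1}^{m-1}C_j&\oplus_{j=1}^{m-1}D_j\\ &&&F\\ &\oslash_{j=m+1}^{2m-1}C_j&\oslash_{j=m+1}^{2m-1}D_j\end{pmatrix},$$ where $C_j=1\oplus\mathrm{diag}\big(\omega_{2km}^{j\ell}(\omega_{2m}^j+1)/2\big)_{1\le\ell<k}$, $D_j=\big((\omega_{2m}^j-\omega_{2m}^{-j})/2\big)\oplus\mathrm{diag}\big(\omega_{2km}^{j\ell}(\omega_{2m}^j-1)/2\big)_{1\le\ell<k}$, $F=1\oplus\mathrm{diag}\big(-\omega_{2k}^j\big)_{1\le j<k}$. Matrix $D^{2km}_m$: $$D^{2km}_m=I_{m+1}\oplus\mathrm{diag}\Big(\tfrac{1}{\sin\frac{(j+1)\pi}{m}}\Big)_{0\le j<m-1}\oplus I_{k-1}\otimes\Big(\mathrm{diag}\Big(\tfrac{1}{\cos\frac{j\pi}{2m}}\Big)_{0\le j<m}\oplus\mathrm{diag}\Big(\tfrac{1}{\sin\frac{(j+1)\pi}{2m}}\Big)_{0\le j<m}\Big).$$ In these expressions $\otimes$ binds more tightly than $\oplus$. Algebra: in $\mathcal{A}=\mathbb{C}[x]/(x^{2km}-1)$, $x^{-k}$ denotes the inverse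 $x^{2km-k}$ of $x^k$. $\langle r(x)\rangle$ is the subalgebra of all (finite) polynomial expressions $\sum_i c_ir^i(x)$, $c_i\in\mathbb{C}$. *)

(* Defs.v *)
From HB Require Import structures.
From mathcomp Require Import all_boot all_order all_algebra all_field.
From mathcomp Require Import complex mxtens reals trigo.
From mathcomp Require Import zify.

Set Implicit Arguments.
Unset Strict Implicit.
Unset Printing Implicit Defensive.

Import GRing.Theory.
Local Open Scope ring_scope.
Local Open Scope complex_scope.

(* Block-diagonal direct sum.  It binds less tightly than the Kronecker       *)
(* product [*t] of mxtens.                                                    *)
Definition dsummx (K : pzRingType) (m n p q : nat)
    (A : 'M[K]_(m, n)) (B : 'M[K]_(p, q)) : 'M[K]_(m + p, n + q) :=
  block_mx A 0 0 B.
Notation "A ⊕ B" := (dsummx A B) (at level 50, left associativity).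

(* Equations between the sizes of block expressions and the size 2km of the   *)
(* matrices; they only serve as arguments of [castmx].                        *)
Section Sizes.
Local Open Scope nat_scope.

Lemma size_tens (k m : nat) : 2 * m * k = 2 * k * m.
Proof. by rewrite mulnAC. Qed.

Lemma size_shift (k m : nat) : 0 < k -> m + m + 2 * k.-1 * m = 2 * k * m.
Proof. case: k => // k _; rewrite /=; nia. Qed.

Lemma size_trig (k m : nat) : 0 < k -> 0 < m ->
  m.+1 + m.-1 + k.-1 * (m + m) = 2 * k * m.
Proof. case: k => // k _; case: m => // m _; rewrite /=; nia. Qed.

Lemma size_butterfly_row (k m : nat) : 0 < k -> 0 < m ->
  (1 + m.-1) + (1 + m.-1) + k.-1 * ((1 + m.-1) + (1 + m.-1)) = 2 * k * m.
Proof. case: k => // k _; case: m => // m _; rewrite /=; nia. Qed.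

Lemma size_butterfly_col (k m : nat) : 0 < k -> 0 < m ->
  (1 + m.-1) + (1 + m.-1) + k.-1 * ((1 + 1) + (m.-1 + m.-1)) = 2 * k * m.
Proof. case: k => // k _; case: m => // m _; rewrite /=; nia. Qed.

Lemma size_X_row (k m : nat) : 0 < m ->
  (k + \sum_(i < m.-1) k) + (k + \sum_(i < m.-1) k) = 2 * k * m.
Proof. by rewrite sum_nat_const card_ord; case: m => // m _ /=; nia. Qed.

Lemma size_X_col (k m : nat) : 0 < m ->
  (k + \sum_(i < m.-1) k) + (\sum_(i < m.-1) k + k) = 2 * k * m.
Proof. by rewrite sum_nat_const card_ord; case: m => // m _ /=; nia. Qed.

End Sizes.

Section Matrices.
Variable R : realType.
Local Notation C := R[i].

(* e^{-2 pi i / n} *)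
Definition omega (n : nat) : C :=
  cos (- (2 * pi / n%:R)) +i* sin (- (2 * pi / n%:R)).

Definition DFT (n : nat) : 'M[C]_n :=
  \matrix_(a < n, l < n) omega n ^+ (a * l).

(* DCT-1 of size m + 1 and DST-1 of size m - 1. *)
Definition DCT1 (m : nat) : 'M[C]_m.+1 :=
  \matrix_(a < m.+1, l < m.+1) (cos ((a * l)%:R * pi / m%:R))%:C.

Definition DST1 (m : nat) : 'M[C]_m.-1 :=
  \matrix_(a < m.-1, l < m.-1) (sin ((a.+1 * l.+1)%:R * pi / m%:R))%:C.

Definition DCT2 (m : nat) : 'M[C]_m :=
  \matrix_(a < m, l < m) (cos (a%:R * (l%:R + 2^-1) * pi / m%:R))%:C.

Definition DST2 (m : nat) : 'M[C]_m :=
  \matrix_(a < m, l < m) (sin (a.+1%:R * (l%:R + 2^-1) * pi / m%:R))%:C.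

Definition Jmx (n : nat) : 'M[C]_n :=
  \matrix_(a < n, l < n) ((l : nat) == (n.-1 - a)%N)%:R.

(* The first row has its 1 in the last column, row j + 1 in column j. *)
Definition Zmx (n : nat) : 'M[C]_n :=
  \matrix_(a < n, l < n) ((a : nat) == l.+1 %% n)%N%:R.

(* Stride permutation L_k^n, meant for k %| n: with m' = n / k, row           *)
(* r = j m' + i (where i < m') has its 1 in column i k + j.                   *)
Definition Lmx (k n : nat) : 'M[C]_n :=
  \matrix_(r < n, c < n)
    ((c : nat) == r %% (n %/ k) * k + r %/ (n %/ k))%N%:R.

Definition B1 (m : nat) : 'M[C]_((1 + m.-1) + (1 + m.-1)) :=
  block_mx
    (block_mx 1%:M 0 0 1%:M) (block_mx 0    0 0 (Jmx m.-1))
    (block_mx 0    0 0 1%:M) (block_mx 1%:M 0 0 (- Jmx m.-1)).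

Definition B2 (m : nat) :
    'M[C]_((1 + m.-1) + (1 + m.-1), (1 + 1) + (m.-1 + m.-1)) :=
  block_mx
    (block_mx 1%:M     1%:M 0 0) (block_mx 0 0 1%:M (Jmx m.-1))
    (block_mx (- 1%:M) 1%:M 0 0) (block_mx 0 0 1%:M (- Jmx m.-1)).

Definition Bmx (k m : nat) (hk : (0 < k)%N) (hm : (0 < m)%N) :
    'M[C]_(2 * k * m) :=
  castmx (size_butterfly_row hk hm, size_butterfly_col hk hm)
    (B1 m ⊕ (1%:M : 'M_k.-1) *t B2 m)
  *m Lmx k (2 * k * m).

Definition Cblock (k m j : nat) : 'M[C]_k :=
  diag_mx (\row_(l < k)
    if (l : nat) == 0%N then 1
    else omega (2 * k * m) ^+ (j * l) * (omega (2 * m) ^+ j + 1) / 2).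

Definition Dblock (k m j : nat) : 'M[C]_k :=
  diag_mx (\row_(l < k)
    if (l : nat) == 0%N then (omega (2 * m) ^+ j - omega (2 * m) ^- j) / 2
    else omega (2 * k * m) ^+ (j * l) * (omega (2 * m) ^+ j - 1) / 2).

Definition Fblock (k : nat) : 'M[C]_k :=
  diag_mx (\row_(j < k)
    if (j : nat) == 0%N then 1 else - omega (2 * k) ^+ j).

(* Block anti-diagonal matrix with A 0 in the top-right corner, down to       *)
(* A n.-1 in the bottom-left corner.                                          *)
Definition antidiagmx (k n : nat) (A : nat -> 'M[C]_k) :
    'M[C]_(\sum_(i < n) k, \sum_(i < n) k) :=
  \mxblock_(i < n, j < n) (if j == rev_ord i then A i else 0).

Definition Xmx (k m : nat) (hm : (0 < m)%N) : 'M[C]_(2 * k * m) :=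
  castmx (size_X_row k hm, size_X_col k hm)
    (block_mx
      (block_mx 1%:M 0
                0    (\mxdiag_(i < m.-1) Cblock k m i.+1))
      (block_mx 0                                   0
                (\mxdiag_(i < m.-1) Dblock k m i.+1) 0)
      (block_mx 0 0
                0 (antidiagmx m.-1 (fun i => Cblock k m (m.+1 + i))))
      (block_mx 0                                              (Fblock k)
                (antidiagmx m.-1 (fun i => Dblock k m (m.+1 + i))) 0)).

Definition Dmx (k m : nat) (hk : (0 < k)%N) (hm : (0 < m)%N) :
    'M[C]_(2 * k * m) :=
  castmx (size_trig hk hm, size_trig hk hm)
    ((1%:M : 'M_m.+1)
     ⊕ diag_mx (\row_(j < m.-1) ((sin (j.+1%:R * pi / m%:R))^-1)%:C)
     ⊕ (1%:M : 'M_k.-1) *t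
         (diag_mx (\row_(j < m) ((cos (j%:R * pi / (2 * m)%:R))^-1)%:C)
          ⊕ diag_mx (\row_(j < m)
                       ((sin (j.+1%:R * pi / (2 * m)%:R))^-1)%:C))).

End Matrices.

(* C[x]/(x^n - 1), with 'qX the class of x. *)
Definition cycalg (R : realType) (n : nat) := {poly %/ ('X^n - 1 : {poly R[i]})}.

HB.instance Definition _ (F : fieldType) (p : {poly F}) :=
  Vector.on {poly %/ p}.
HB.instance Definition _ (R : realType) (n : nat) :=
  Falgebra.on (cycalg R n).

(* [{poly %/ p}] is the quotient by 'X when p is not monic of positive        *)
(* degree; this does not happen here.                                         *)
Lemma mk_monic_cyc (R : realType) (n : nat) :
  (0 < n)%N -> mk_monic ('X^n - 1 : {poly R[i]}) = 'X^n - 1.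
Proof.
by move=> n0; rewrite /mk_monic size_XnsubC // ltnS n0 monicXnsubC.
Qed.

Section Transversal.
Variables (F : fieldType) (A : falgType F).

(* The span of the powers of r, i.e. the set of polynomial expressions in r:  *)
(* see [mem_subalg].                                                          *)
Definition subalg (r : A) : {vspace A} := agenv <[r]>.

Lemma mem_subalg (r b : A) :
  b \in subalg r <-> exists c : {poly F}, b = horner_alg r c.
Proof.
split=> [|[c ->]].
  rewrite /subalg /agenv => /memv_sumP[v vr ->].
  have vE (i : 'I_(\dim {:A})) : exists a, v i == a *: r ^+ i.
    by have := vr i isT; rewrite expv_line => /vlineP[a ->]; exists a.
  exists (\sum_(i < \dim {:A}) xchoose (vE i) *: 'X^i).
  rewrite linear_sum /=; apply: eq_bigr => i _.
  rewrite linearZ rmorphXn /= horner_algX mulr_algl.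
  exact: eqP (xchooseP (vE i)).
rewrite -[c]coefK poly_def linear_sum /=; apply: memv_suml => i _.
rewrite linearZ rmorphXn /= horner_algX mulr_algl; apply: memvZ.
rewrite /subalg; apply: (subvP (subX_agenv <[r]> i)).
by rewrite expv_line memv_line.
Qed.

(* A is the direct sum of the subspaces t l * B = {t l * b | b \in B}. *)
Definition transversal_of (n : nat) (t : nat -> A) (B : {vspace A}) : Prop :=
  directv (\sum_(l < n) (amull (t l) @: B)%VS)%VS
  /\ (\sum_(l < n) (amull (t l) @: B)%VS)%VS = fullv.

End Transversal.

Section CyclicAlgebra.
Variables (R : realType) (k m : nat).
Local Notation n := (2 * k * m)%N.
Local Notation x := ('qX : cycalg R n).

Definition xk : cycalg R n := x ^+ k.
(* The inverse of x^k. *)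
Definition xkV : cycalg R n := x ^+ (n - k).

Definition tpoly (l : nat) : cycalg R n :=
  if l == 0%N then 1
  else if l == 1%N then (2^-1 : R[i]) *: (xk - xkV)
  else if odd l then (2^-1 : R[i]) *: (x ^+ l./2 * (xk - 1))
  else (2^-1 : R[i]) *: (x ^+ l./2 * (xk + 1)).

Definition Balg : {vspace cycalg R n} := subalg ((2^-1 : R[i]) *: (xk + xkV)).

End CyclicAlgebra.

(* Main.v *)
(* Splitting a column index as [c = q k + l] and putting [y = x^k], column [c]
   of the DFT evaluates [y^q x^l].  After the stride permutation [L_k] the
   butterfly and trigonometric stages act on each of the [k] residues [l]
   separately: they yield cos(s q pi/m) and sin(s q pi/m) when [l = 0], and
   cos(s (2q-1) pi/2m) and sin(s (2q-1) pi/2m) when [l > 0], for [0 <= q < 2m].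
   The rows of [X] recombine a cosine row and a sine row by
     (cis(-2b) + 1)/2 cos(a)/cos(b) + (cis(-2b) - 1)/2 sin(a)/sin(b) = cis(-b-a)
   with [cis x = exp(i x)], which gives omega_n^(j (q k + l)) in row [j].  The
   remaining [L_k (I (x) DFT_k)] is a Cooley-Tukey step.

   For the transversal, [t_l B] is spanned by a palindromic or antipalindromic
   family g (y^(i+e) +- y^-i), which obeys the three-term recurrence of
   multiplication by [y + y^-1].  The reflection of the index bounds the
   dimensions by m+1, m-1, m, ..., m, whose sum is 2km; half sums of the two
   families with the same [g] give all powers of [x], so that the sum of the
   [t_l B] is everything and hence direct. *)
Require Import Defs.
From mathcomp Require Import all_boot all_order all_algebra all_field.
From mathcomp Require Import complex mxtens reals trigo.
From mathcomp Require Import ring zify.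

Set Implicit Arguments.
Unset Strict Implicit.
Unset Printing Implicit Defensive.

Import Order.TTheory GRing.Theory Num.Theory.
Local Open Scope ring_scope.

(** * Three-term recurrences of palindromic and antipalindromic families *)

Section Palindromic.
Variables (T : comNzRingType) (y z : T).
Implicit Types (g : T) (b : bool) (e i : nat).

(** For [z] inverse to [y], this is formally [g y^(e/2)] times [y^s + y^-s] or [y^s - y^-s] with
    [s = i + e/2]: the analogue of a cosine or a sine, of whole or half-integer index. *)
Definition palindromic g b e i : T := g * (y ^+ (i + e) + (-1) ^+ b * z ^+ i).

Hypothesis yz1 : y * z = 1.

Lemma palindromicS2 g b e i :
  palindromic g b e i.+2 = palindromic g b e i.+1 * (y + z) - palindromic g b e i.
Proof. by rewrite /palindromic !addSn !exprS; case: b; ring: yz1. Qed.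

(** The recurrence continued to index -1: there the two terms swap roles, which gives the member of
    index [1 - e] up to the sign [(-1)^b]. *)
Lemma palindromic0_mul g b e : (e <= 1)%N ->
  palindromic g b e 0 * (y + z)
  = palindromic g b e 1 + (-1) ^+ b * palindromic g b e (1 - e).
Proof.
by case: e => [|[|e]] // _; rewrite /palindromic; case: b => /=; ring: yz1.
Qed.

End Palindromic.

(** * Translates [t B] of a subalgebra generated by one element *)

Section Subalgebra.
Variables (F : fieldType) (A : falgType F).
Implicit Types (r t : A) (V : {vspace A}).

Lemma subalg_stable r b : b \in subalg r -> b * r \in subalg r.
Proof.
move=> /mem_subalg[c ->]; apply/mem_subalg; exists (c * 'X).
by rewrite rmorphM /= horner_algX.
Qed.

Lemma subalg1 r : 1 \in subalg r.
Proof. by apply/mem_subalg; exists 1; rewrite rmorph1. Qed.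

Lemma img_subalg_stable t r v :
  v \in (amull t @: subalg r)%VS -> v * r \in (amull t @: subalg r)%VS.
Proof.
move=> /memv_imgP[b bB ->]; rewrite lfunE /= -mulrA.
by have := memv_img (amull t) (subalg_stable bB); rewrite lfunE.
Qed.

(** The elements [t r^i] span the translate. Any stable [V] containing [t] thus bounds the dimension
    of [t B] from above. *)
Lemma img_subalg_subv t r V : t \in V ->
  (forall v, v \in V -> v * r \in V) -> (amull t @: subalg r <= V)%VS.
Proof.
move=> tV stV; apply/subvP => _ /memv_imgP[b /mem_subalg[c ->] ->].
rewrite lfunE /= -[c]coefK poly_def linear_sum /= mulr_sumr.
apply: memv_suml => i _; rewrite linearZ rmorphXn /= horner_algX mulr_algl.
rewrite -scalerAr; apply: memvZ.
elim: (val i) => [|j IHj]; first by rewrite mulr1.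
by rewrite exprSr mulrA stV.
Qed.

Lemma mem_three_term r V (f : nat -> A) :
    (forall v, v \in V -> v * r \in V) -> f 0%N \in V -> f 1%N \in V ->
    (forall i, f i.+2 = f i.+1 * r - f i) ->
  forall i, f i \in V.
Proof.
move=> stV f0 f1 fS i.
suff [] : f i \in V /\ f i.+1 \in V by [].
by elim: i => // i [fi fi1]; split; rewrite // fS rpredB // stV.
Qed.

End Subalgebra.

(** * The transversal: dimension bounds and spanning *)

Section Transversal.
Variables (R : realType) (k m : nat) (hk : (0 < k)%N) (hm : (0 < m)%N).
Local Notation n := (2 * k * m)%N.
Local Notation x := ('qX : cycalg R n).
Local Notation y := (xk R k m).
Local Notation z := (xkV R k m).
Local Notation S t := (amull t @: Balg R k m)%VS.

Let n_gt0 : (0 < n)%N. Proof. by rewrite !muln_gt0 hk hm. Qed.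

Lemma cycX_n : x ^+ n = 1.
Proof.
rewrite -[x]/(in_qpoly _ 'X) -rmorphXn /=.
apply/val_inj; rewrite /= mk_monic_cyc //.
rewrite -{1}['X^n](subrK 1) -[X in X + 1]mul1r.
rewrite Pdiv.RingMonic.rmodp_addl_mul_small ?monicXnsubC //.
by rewrite size_XnsubC // size_poly1 ltnS.
Qed.

Lemma xk_mul_xkV : y * z = 1.
Proof.
by rewrite -exprD subnKC ?cycX_n // -mulnA mulnCA leq_pmulr // muln_gt0 hm.
Qed.

Lemma xk_pow2m : y ^+ (2 * m) = 1.
Proof. by rewrite -exprM mulnCA mulnA cycX_n. Qed.

Lemma xk_pow_xkV i j : (i + j = 2 * m)%N -> y ^+ i = z ^+ j.
Proof.
move=> ij; rewrite -[LHS]mulr1 -(expr1n _ j) -xk_mul_xkV exprMn mulrA -exprD ij.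
by rewrite xk_pow2m mul1r.
Qed.

Lemma cyc_span (V : {vspace cycalg R n}) :
  (forall e, x ^+ e \in V) -> V = fullv.
Proof.
move=> xV; apply/vspaceP => v; rewrite memvf.
have -> : v = in_qpoly _ (v : {poly _}).
  by apply/val_inj/esym/in_qpoly_small/size_mk_monic.
rewrite -[polyn v]coefK poly_def raddf_sum /=; apply: memv_suml => i _.
by rewrite in_qpolyZ rmorphXn; apply/memvZ/xV.
Qed.

(** The generator of [Balg] is half of [y + z], whereas the recurrences concern [y + z] itself. *)
Lemma scale_half_stable (V : {vspace cycalg R n}) :
  (forall v, v \in V -> v * (y + z) \in V) ->
  forall v, v \in V -> v * ((2^-1 : R[i]) *: (y + z)) \in V.
Proof. by move=> stV v vV; rewrite -scalerAr; apply/memvZ/stV. Qed.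

Lemma img_Balg_stable t v : v \in S t -> v * (y + z) \in S t.
Proof.
have two0 : 2 != 0 :> R[i] by rewrite pnatr_eq0.
move=> vS; rewrite -[y + z]scale1r -(divff two0).
by rewrite -scalerA -scalerAr; apply/memvZ/img_subalg_stable.
Qed.

Local Notation fam := (palindromic y z).

(** From [y^(2m) = 1] follow [y^(j+e) = z^i] and [z^j = y^(i+e)]: the two terms are exchanged, at
    the cost of a sign. *)
Lemma palindromic_refl g b e i j : (i + j + e = 2 * m)%N ->
  fam g b e j = (-1) ^+ b * fam g b e i.
Proof.
move=> ij; rewrite /palindromic (@xk_pow_xkV (j + e) i) ?(@xk_pow_xkV (i + e) j); try lia.
by rewrite mulrCA; congr (_ * _); rewrite mulrDr signrMK; exact: addrC.
Qed.

(* The indices [0 <= i] with [i + e <= m] represent all of them up to the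
   reflection, so they span a subspace stable under [y + z]. *)
Lemma dim_img_palindromic (t g : cycalg R n) b e a d :
    (e <= 1)%N -> (a + d + e <= m.+1)%N ->
    let V := <<mkseq (fun i => fam g b e (a + i)) d>>%VS in
    t \in V -> (forall i, (i + e <= m)%N -> fam g b e i \in V) ->
  (\dim (S t) <= d)%N.
Proof.
move=> e1 ade V tV fV; apply: (@leq_trans (\dim V)); last first.
  by rewrite (leq_trans (dim_span _)) ?size_mkseq.
(* The recurrence at the largest index asks for one index more, with [i + e = m + 1]; the reflection
   sends it to [m - 1]. *)
have fV' i : (i + e <= m.+1)%N -> fam g b e i \in V.
  rewrite leq_eqVlt => /orP[/eqP ie|]; last exact: fV.
  rewrite (@palindromic_refl _ _ _ (2 * m - e - i)); last lia.
  by rewrite rpredMsign fV //; lia.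
apply/dimvS/img_subalg_subv => //; apply: scale_half_stable => v vV.
have: (amulr (y + z) @: V <= V)%VS.
  rewrite limg_span; apply/span_subvP => _ /mapP[_ /mapP[i + ->] ->].
  rewrite mem_iota lfunE /= => id.
  have [->|ai] := posnP (a + i)%N.
    by rewrite (palindromic0_mul xk_mul_xkV _ _) //; apply: rpredD;
      rewrite ?rpredMsign; apply: fV'; lia.
  have := palindromicS2 xk_mul_xkV g b e (a + i).-1; rewrite prednK // => /eqP.
  rewrite eq_sym subr_eq => /eqP ->.
  by apply: rpredD; apply: fV'; lia.
move/subvP; apply; have := memv_img (amulr (y + z)) vV.
by rewrite lfunE.
Qed.
(** For [e = 1] the boundary relation yields the member of index 1 from that of index 0. For [e = 0]
    it yields only [1 + (-1)^b] times that member, which is zero for [b] true, so index 1 has its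
    own hypothesis. *)
Lemma palindromic_mem (V : {vspace cycalg R n}) g b e : (e <= 1)%N ->
    (forall v, v \in V -> v * (y + z) \in V) ->
    fam g b e 0 \in V -> (e = 0%N -> fam g b e 1 \in V) ->
  forall i, fam g b e i \in V.
Proof.
move=> e1 stV f0 f1; apply: (mem_three_term stV f0) => [|i]; last first.
  exact: palindromicS2 xk_mul_xkV g b e i.
case: e e1 f0 f1 => [_ _|[|//] _ f0 _]; first exact.
have /eqP := palindromic0_mul xk_mul_xkV g b (leqnn 1).
rewrite -subr_eq => /eqP <-.
by rewrite rpredB ?rpredMsign // stV.
Qed.

Lemma half_double (v : cycalg R n) : (2^-1 : R[i]) *: (v + v) = v.
Proof.
by rewrite -mulr2n -[X in _ *: X](scaler_nat 2) scalerA mulVf ?scale1r ?pnatr_eq0.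
Qed.

Lemma palindromic_half g i :
  g * y ^+ i = 2^-1 *: (fam g false 0 i + fam g true 0 i).
Proof.
rewrite /palindromic addn0 /= expr0 expr1 mul1r mulN1r -mulrDr addrACA subrr.
by rewrite addr0 mulrDr half_double.
Qed.

Lemma palindromic_half1 g i :
  g * y ^+ i.+1 = 2^-1 *: (fam g false 1 i + fam g true 1 i).
Proof.
rewrite /palindromic addn1 /= expr0 expr1 mul1r mulN1r -mulrDr addrACA subrr.
by rewrite addr0 mulrDr half_double.
Qed.

(** For [e = 0] the reflection fixes 0 and [m] modulo 2m, and an antisymmetric family vanishes
    there. This accounts for the bound [m - 1] in the case of [t_1]. *)
Lemma antipalindromic0 g i : i \in [:: 0%N; m] -> fam g true 0 i = 0.
Proof.
rewrite !inE /palindromic addn0 => /orP[] /eqP ->.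
  by rewrite !expr0 mulr1 subrr mulr0.
by rewrite (@xk_pow_xkV m m) ?mulN1r ?subrr ?mulr0 //; lia.
Qed.

Lemma tpolyE0 : tpoly R k m 0 = 2^-1 *: fam 1 false 0 0.
Proof.
by rewrite /palindromic !expr0 !mul1r half_double.
Qed.

(** The family starts at index 1 here, its member of index 0 being zero. *)
Lemma tpolyE1 : tpoly R k m 1 = 2^-1 *: fam 1 true 0 1.
Proof. by rewrite /palindromic mul1r mulN1r. Qed.

Lemma tpolyE j (b : bool) : tpoly R k m (b + j.+1.*2) = 2^-1 *: fam (x ^+ j.+1) b 1 0.
Proof.
rewrite /tpoly oddD odd_double addbF oddb half_bit_double.
rewrite /palindromic expr0 mulr1.
by case: b; rewrite ?mulN1r // mul1r.
Qed.

Lemma mem_scale_half (V : {vspace cycalg R n}) v : (2^-1 *: v \in V) = (v \in V).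
Proof. by rewrite rpredZeq invr_eq0 pnatr_eq0. Qed.

Lemma mem_img_Balg t : t \in S t.
Proof.
by have := memv_img (amull t) (subalg1 _); rewrite lfunE /= mulr1; apply.
Qed.

(** The bounds count indices up to reflection: 0 to [m], then 1 to [m - 1] as both ends vanish, then
    0 to [m - 1] for each half-integer family. *)
Lemma dim_tpoly l :
  (\dim (S (tpoly R k m l))
     <= (if l == 0 then m.+1 else if l == 1 then m.-1 else m))%N.
Proof.
have mem g b e a d i : (a <= i < a + d)%N ->
    fam g b e i \in <<mkseq (fun i => fam g b e (a + i)) d>>%VS.
  move=> /andP[ai id]; rewrite -(subnKC ai); apply/memv_span.
  by apply/map_f; rewrite mem_iota; lia.
case: l => [|[|l]] /=.
- apply: (@dim_img_palindromic _ 1 false 0 0) => [//|//||i im]; first by lia.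
    by rewrite tpolyE0 mem_scale_half mem.
  by rewrite mem; lia.
- have fV i : (i <= m)%N ->
      fam 1 true 0 i \in <<mkseq (fun i => fam 1 true 0 (1 + i)) m.-1>>%VS.
    move=> im; have [/antipalindromic0 ->|i0m] := boolP (i \in [:: 0%N; m]).
      exact: mem0v.
    by apply: mem; move: i0m; rewrite !inE; lia.
  apply: (@dim_img_palindromic _ 1 true 0 1) => [//|||i im]; first by lia.
    by rewrite tpolyE1 mem_scale_half fV.
  by apply: fV; lia.
have -> : l.+2 = (odd l + (l./2).+1.*2)%N by lia.
rewrite tpolyE.
apply: (@dim_img_palindromic _ (x ^+ (l./2).+1) (odd l) 1 0) => [//|||i im].
- by lia.
- by rewrite mem_scale_half mem.
by rewrite mem; lia.
Qed.

Lemma sum_tpoly_dim :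
  (\sum_(l < 2 * k) \dim (S (tpoly R k m l)) <= n)%N.
Proof.
apply: (@leq_trans (\sum_(l < 2 * k)
    (if l == 0 :> nat then m.+1 else if l == 1 :> nat then m.-1 else m))).
  by apply: leq_sum => l _; exact: dim_tpoly.
have -> : (2 * k = (2 * k).-2.+2)%N by lia.
rewrite !big_ord_recl /= sum_nat_const card_ord; nia.
Qed.

Lemma tpoly_sum_full :
  (\sum_(l < 2 * k) S (tpoly R k m l))%VS = fullv.
Proof.
set W := (\sum_(l < _) _)%VS.
have SW l v : (l < 2 * k)%N -> v \in S (tpoly R k m l) -> v \in W.
  move=> lk; apply/subvP.
  by rewrite -[l]/(nat_of_ord (Ordinal lk)); apply: sumv_sup.
have gW j i : (j < k)%N -> x ^+ j * y ^+ i \in W.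
  move=> jk; case: j jk => [_|j jk].
    rewrite palindromic_half mem_scale_half; apply: rpredD.
      apply: (SW 0%N); first by lia.
      apply: palindromic_mem => //; first exact: img_Balg_stable.
        by rewrite -mem_scale_half -tpolyE0 mem_img_Balg.
      move=> _; rewrite /palindromic expr0 mul1r expr1 mul1r.
      by rewrite -[y + z]mul1r; apply/img_Balg_stable/mem_img_Balg.
    apply: (SW 1%N); first by lia.
    apply: palindromic_mem => //; first exact: img_Balg_stable.
      by rewrite antipalindromic0 ?mem0v ?inE.
    by rewrite -mem_scale_half -tpolyE1 mem_img_Balg.
  (* With [e = 1] the half sums give positive exponents of [y] only; adding the period 2m makes the
     exponent positive. *)
  have -> : y ^+ i = y ^+ (i + 2 * m).-1.+1.
    have -> : ((i + 2 * m).-1.+1 = i + 2 * m)%N by move: hm; clear; lia.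
    by rewrite exprD xk_pow2m mulr1.
  rewrite palindromic_half1 mem_scale_half; apply: rpredD.
    apply: (SW (false + j.+1.*2)%N); first by rewrite /= ; lia.
    apply: palindromic_mem => //; first exact: img_Balg_stable.
    by rewrite -mem_scale_half -tpolyE mem_img_Balg.
  apply: (SW (true + j.+1.*2)%N); first by rewrite /=; lia.
  apply: palindromic_mem => //; first exact: img_Balg_stable.
  by rewrite -mem_scale_half -tpolyE mem_img_Balg.
apply: cyc_span => e.
have -> : (e = e %% k + k * (e %/ k))%N by rewrite addnC mulnC -divn_eq.
rewrite exprD (exprM _ k).
by apply: gW; rewrite ltn_mod.
Qed.

Lemma tpoly_transversal :
  transversal_of (2 * k) (tpoly R k m) (Balg R k m).
Proof.
split; last exact: tpoly_sum_full.
(* The dimensions add up to at most 2km, the dimension of the sum, which forces directness. *)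
rewrite directvEgeq /= tpoly_sum_full.
rewrite (leq_trans sum_tpoly_dim) // dim_polyn.
by rewrite mk_monic_cyc // size_XnsubC.
Qed.
End Transversal.

(** * Quotients and remainders of block indices *)

Lemma divn_block u v s : (v < s)%N -> ((u * s + v) %/ s = u)%N.
Proof. by move=> vs; rewrite divnMDl ?(leq_ltn_trans _ vs) // divn_small ?addn0. Qed.

Lemma modn_block u v s : (v < s)%N -> ((u * s + v) %% s = v)%N.
Proof. by move=> vs; rewrite modnMDl modn_small. Qed.

Lemma ltn_block t s u v : (u < t)%N -> (v < s)%N -> (u * s + v < t * s)%N.
Proof.
by move=> ut vs; rewrite -ltn_divLR ?divn_block // (leq_ltn_trans _ vs).
Qed.

(** * Matrices as functions of natural indices: block diagonal and strided forms *)

Section EntryFunctions.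
Variable K : pzRingType.
Implicit Types (p q N k s t : nat) (f g : nat -> nat -> K).
Implicit Types F G : nat -> nat -> nat -> K.

(* Matrices given by a function on natural indices: casts between equal sizes
   disappear, and only index arithmetic is left. *)
Definition mxf p q f : 'M[K]_(p, q) := \matrix_(i, j) f i j.

Lemma eq_mxf p q f g :
  (forall i j, (i < p)%N -> (j < q)%N -> f i j = g i j) -> mxf p q f = mxf p q g.
Proof. by move=> fg; apply/matrixP => i j; rewrite !mxE fg. Qed.

Lemma mxf0 p q : 0 = mxf p q (fun _ _ => 0).
Proof. by apply/matrixP => i j; rewrite !mxE. Qed.

Lemma mxf1 p : 1%:M = mxf p p (fun i j => (i == j)%:R).
Proof. by apply/matrixP => i j; rewrite !mxE. Qed.

Lemma mxf_diag p (d : nat -> K) :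
  diag_mx (\row_(i < p) d i) = mxf p p (fun i j => if i == j then d i else 0).
Proof. by apply/matrixP => i j; rewrite !mxE mulrb -val_eqE; case: eqP. Qed.

Lemma castmx_mxf p q p' q' (e : (p = p') * (q = q')) f :
  castmx e (mxf p q f) = mxf p' q' f.
Proof. by apply/matrixP => i j; rewrite castmxE !mxE. Qed.

Lemma block_mxf p1 p2 q1 q2 f1 f2 f3 f4 :
  block_mx (mxf p1 q1 f1) (mxf p1 q2 f2) (mxf p2 q1 f3) (mxf p2 q2 f4)
  = mxf (p1 + p2) (q1 + q2) (fun i j =>
      if (i < p1)%N then if (j < q1)%N then f1 i j else f2 i (j - q1)%N
      else if (j < q1)%N then f3 (i - p1)%N j else f4 (i - p1)%N (j - q1)%N).
Proof.
apply/matrixP => i j; rewrite [RHS]mxE.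
case: (split_ordP i) => i' ->; case: (split_ordP j) => j' ->;
  rewrite ?(block_mxEul, block_mxEur, block_mxEdl, block_mxEdr) mxE /=;
  by rewrite ?ltn_ord ?(ltnNge (_ + _)) ?leq_addr ?addKn.
Qed.

Lemma mul_mxf p q N f g :
  mxf p q f *m mxf q N g = mxf p N (fun i j => \sum_(r < q) f i r * g r j).
Proof. by apply/matrixP => i j; rewrite !mxE; apply: eq_bigr => r _; rewrite !mxE. Qed.

Lemma sum_delta N r (h : nat -> K) :
  (r < N)%N -> \sum_(i < N) (if i == r :> nat then h i else 0) = h r.
Proof.
move=> rN; rewrite (bigD1 (Ordinal rN)) //= eqxx big1 ?addr0 // => i.
by rewrite -val_eqE /= => /negPf ->.
Qed.

Lemma sum_divmod t s (h : nat -> K) :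
  \sum_(i < (t * s)%N) h i = \sum_(u < t) \sum_(v < s) h (u * s + v)%N.
Proof.
rewrite pair_big /=.
(* The bijection between pairs and indices is that of the Kronecker product. *)
rewrite (reindex (@mxtens_index t s)) /=; last first.
  by exists (@mxtens_unindex t s) => i _; rewrite (mxtens_indexK, mxtens_unindexK).
by apply: eq_bigr => -[].
Qed.

Lemma dsum_mxf p1 p2 q1 q2 f g :
  mxf p1 q1 f ⊕ mxf p2 q2 g = mxf (p1 + p2) (q1 + q2) (fun i j =>
    if (i < p1)%N then if (j < q1)%N then f i j else 0
    else if (j < q1)%N then 0 else g (i - p1)%N (j - q1)%N).
Proof. by rewrite /dsummx !mxf0 block_mxf. Qed.

Definition diagf (d : nat -> K) i j : K := if i == j then d i else 0.

Lemma mxf1_diagf p : 1%:M = mxf p p (diagf (fun _ => 1)).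
Proof.
by rewrite mxf1; apply: eq_mxf => i j _ _; rewrite /diagf; case: eqP.
Qed.

Lemma dsum_diagf p1 p2 d1 d2 :
  mxf p1 p1 (diagf d1) ⊕ mxf p2 p2 (diagf d2)
  = mxf (p1 + p2) (p1 + p2)
      (diagf (fun i => if (i < p1)%N then d1 i else d2 (i - p1)%N)).
Proof.
rewrite dsum_mxf; apply: eq_mxf => i j _ _; rewrite /diagf.
have [->|/eqP ij] := eqVneq i j; first by rewrite !eqxx; case: ltnP.
case: ltnP => ip; case: ltnP => jp //.
by case: eqP => // e; case: ij; rewrite -(subnK ip) e subnK.
Qed.

(* Entries of the block diagonal matrix whose [l]-th block, of size [s], is [F l]. *)
Definition bdf s F i j : K :=
  if (i %/ s == j %/ s)%N then F (i %/ s)%N (i %% s)%N (j %% s)%N else 0.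

(** The sizes equal [s] only by a proved equation, since the blocks have sizes such as [m.+1 + m.-1]
    and [m + m], all equal to 2m. *)
Lemma dsum_bdf p1 p2 q1 q2 s f F : (0 < s)%N -> p1 = s -> q1 = s ->
  mxf p1 q1 f ⊕ mxf p2 q2 (bdf s F)
  = mxf (p1 + p2) (q1 + q2) (bdf s (fun l => if l is l'.+1 then F l' else f)).
Proof.
move=> s0 e1 e2; rewrite /dsummx !mxf0 block_mxf e1 e2; apply: eq_mxf => i j _ _.
have split_div r : (s <= r -> r %/ s = ((r - s) %/ s).+1 /\ r %% s = (r - s) %% s)%N.
  by move=> sr; rewrite -{1 3}(subnK sr) divnDr // divnn s0 addn1 modnDr.
rewrite /bdf; case: (ltnP i s) => [lis|/split_div[-> ->]];
  case: (ltnP j s) => [ljs|/split_div[-> ->]];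
  by rewrite ?(divn_small lis) ?(modn_small lis) ?(divn_small ljs)
             ?(modn_small ljs) // eqSS.
Qed.

Lemma tens1_bdf t p q s f : p = s -> q = s ->
  (1%:M : 'M_t) *t mxf p q f = mxf (t * p) (t * q) (bdf s (fun _ => f)).
Proof.
move=> -> ->; apply/matrixP => i j; rewrite !mxE -val_eqE /= /bdf.
by case: eqP => _; rewrite ?mul1r ?mul0r.
Qed.

(** The common shape of the butterfly, scaling and trigonometric stages: one special block for
    residue 0, then equal blocks for the other residues. *)
Lemma cast_dsum_tens p1 q1 p2 q2 t N s f g
    (e : (p1 + t * p2 = N)%N) (e' : (q1 + t * q2 = N)%N) :
    (0 < s)%N -> p1 = s -> q1 = s -> p2 = s -> q2 = s ->
  castmx (e, e') (mxf p1 q1 f ⊕ (1%:M : 'M_t) *t mxf p2 q2 g)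
  = mxf N N (bdf s (fun l => if l is _.+1 then g else f)).
Proof.
move=> s0 es1 es2 es3 es4.
by rewrite (tens1_bdf _ _ es3 es4) (dsum_bdf _ _ _ _ s0 es1 es2) castmx_mxf.
Qed.

Lemma mxf1_bdf p s : 1%:M = mxf p p (bdf s (fun _ i j => (i == j)%:R)).
Proof.
rewrite mxf1; apply: eq_mxf => i j _ _; rewrite /bdf.
case: (altP (i =P j)) => [->|ij]; first by rewrite !eqxx.
case: eqP => // ij1; case: eqP => // ij2; case/eqP: ij.
by rewrite (divn_eq i s) ij1 ij2 -divn_eq.
Qed.

Lemma mul_bdf N t s F G : N = (t * s)%N ->
  mxf N N (bdf s F) *m mxf N N (bdf s G)
  = mxf N N (bdf s (fun l i j => \sum_(r < s) F l i r * G l r j)).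
Proof.
move=> ->; rewrite mul_mxf; apply: eq_mxf => i j its jts.
have s0 : (0 < s)%N by move: its; case: (s) => //; rewrite muln0.
rewrite (sum_divmod _ _ (fun r => bdf s F i r * bdf s G r j)).
pose h u := if u == (j %/ s)%N then
  \sum_(v < s) F u (i %% s)%N v * G u v (j %% s)%N else 0.
transitivity (\sum_(u < t) if u == (i %/ s)%N :> nat then h u else 0).
  apply: eq_bigr => u _; rewrite /h /bdf eq_sym.
  under eq_bigr => v _ do rewrite divn_block // modn_block //.
  case: eqP => [<-|_]; last by rewrite big1 // => v _; rewrite mul0r.
  by case: eqP => // _; rewrite big1 // => v _; rewrite mulr0.
by rewrite sum_delta ?ltn_divLR // /h /bdf.
Qed.

(* Entries of the conjugate of a block diagonal matrix by a stride permutation: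
   [F l] acts on the indices congruent to [l] modulo [k]. *)
Definition cbf k F i j : K :=
  if (i %% k == j %% k)%N then F (i %% k)%N (i %/ k)%N (j %/ k)%N else 0.

Lemma eq_cbf p q t s k F G : (0 < k)%N -> p = (t * k)%N -> q = (s * k)%N ->
  (forall l i j, (l < k)%N -> (i < t)%N -> (j < s)%N -> F l i j = G l i j) ->
  mxf p q (cbf k F) = mxf p q (cbf k G).
Proof.
move=> k0 -> -> FG; apply: eq_mxf => i j it js; rewrite /cbf.
by case: ifP => // _; rewrite FG ?ltn_mod ?ltn_divLR.
Qed.

Lemma mxf0_cbf p q k : 0 = mxf p q (cbf k (fun _ _ _ => 0)).
Proof. by rewrite mxf0; apply: eq_mxf => i j _ _; rewrite /cbf if_same. Qed.

Lemma diag_cbf k (d : nat -> K) :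
  diag_mx (\row_(i < k) d i) = mxf k k (cbf k (fun l _ _ => d l)).
Proof.
rewrite mxf_diag; apply: eq_mxf => i j ik jk.
by rewrite /cbf !modn_small.
Qed.

Lemma block_cbf p1 p2 q1 q2 k t s F1 F2 F3 F4 :
    (0 < k)%N -> p1 = (t * k)%N -> q1 = (s * k)%N ->
  block_mx (mxf p1 q1 (cbf k F1)) (mxf p1 q2 (cbf k F2))
           (mxf p2 q1 (cbf k F3)) (mxf p2 q2 (cbf k F4))
  = mxf (p1 + p2) (q1 + q2) (cbf k (fun l i j =>
      if (i < t)%N then if (j < s)%N then F1 l i j else F2 l i (j - s)%N
      else if (j < s)%N then F3 l (i - t)%N j else F4 l (i - t)%N (j - s)%N)).
Proof.
move=> k0 -> ->; rewrite block_mxf; apply: eq_mxf => i j _ _.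
have shift u r : (u * k <= r ->
    (r - u * k) %/ k = r %/ k - u /\ (r - u * k) %% k = r %% k)%N.
  move=> ur; split; first exact: divnBMl.
  by rewrite -[in RHS](subnKC ur) modnMDl.
rewrite /cbf !ltn_divLR //; case: ltnP => [_|/shift[-> ->]];
  by case: ltnP => [_|/shift[-> ->]].
Qed.

(** Strided entries in a block of size [k] make it diagonal; a block matrix of such blocks links
    only indices congruent modulo [k]. *)
Lemma mxblock_cbf t k F (A : 'I_t -> 'I_t -> 'M[K]_k) :
    (forall i j, A i j = mxf k k (cbf k (fun l _ _ => F l i j))) ->
  \mxblock_(i, j) A i j
  = mxf (\sum_(i < t) k) (\sum_(i < t) k) (cbf k F).
Proof.
move=> AE; apply/mxblockP => i j; rewrite mxblockK AE.
have rankE (u : 'I_t) (v : 'I_k) :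
    (tagnat.Rank u v : nat) = (u * k + v)%N :> nat.
  rewrite tagnat.RankEsum -(big_ord_widen t (fun _ => k) (ltnW (ltn_ord u))).
  by rewrite sum_nat_const card_ord.
apply/matrixP => u v; have k0 : (0 < k)%N := leq_ltn_trans (leq0n _) (ltn_ord u).
by rewrite !mxE !rankE /cbf !modn_block // !divn_block // !modn_small.
Qed.

Lemma mul_cbf N t k F G : N = (t * k)%N ->
  mxf N N (cbf k F) *m mxf N N (cbf k G)
  = mxf N N (cbf k (fun l i j => \sum_(r < t) F l i r * G l r j)).
Proof.
move=> ->; rewrite mul_mxf; apply: eq_mxf => i j itk jtk.
have k0 : (0 < k)%N by move: itk; case: (k) => //; rewrite muln0.
rewrite (sum_divmod _ _ (fun r => cbf k F i r * cbf k G r j)).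
rewrite [RHS]/cbf; case: eqP => [ij|/eqP ij].
  apply: eq_bigr => u _.
  pose h v := F v (i %/ k)%N u * G v u (j %/ k)%N.
  transitivity (\sum_(v < k) if v == (i %% k)%N :> nat then h v else 0).
    apply: eq_bigr => v _; rewrite /cbf modn_block // divn_block //.
    rewrite -ij eq_sym; case: eqP => [->|_]; last by rewrite mul0r.
    by [].
  by rewrite sum_delta ?ltn_mod.
apply: big1 => u _; apply: big1 => v _; rewrite /cbf modn_block //.
case: eqP => [<-|_]; last by rewrite mul0r.
by rewrite (negPf ij) mulr0.
Qed.

End EntryFunctions.

(** * Stride permutations and the Cooley-Tukey step *)

Section Stride.
Variable R : realType.
Local Notation C := R[i].
Implicit Types (N a b : nat).

Lemma mul_Lmxf N a b p (f : nat -> nat -> C) : N = (a * b)%N ->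
  Lmx R a N *m mxf N p f
  = mxf N p (fun r c => f (r %% b * a + r %/ b)%N c).
Proof.
move=> Nab; apply/matrixP => r c; rewrite !mxE.
have [a0 b0] : (0 < a /\ 0 < b)%N.
  by apply/andP; rewrite -muln_gt0 -Nab (leq_ltn_trans (leq0n _) (ltn_ord r)).
have rb : (r %/ b < a)%N by rewrite ltn_divLR // -Nab.
have sN : (r %% b * a + r %/ b < N)%N.
  by rewrite [X in (_ < X)%N]Nab (mulnC a) ltn_block ?ltn_mod.
have Nb : (N %/ a = b)%N by rewrite Nab mulKn.
rewrite -(sum_delta (fun l => f l c) sN); apply: eq_bigr => l _.
by rewrite !mxE Nb; case: eqP => _; rewrite ?mul1r ?mul0r.
Qed.

(** Columns are permuted by the inverse of the row permutation, which again exchanges the two digits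
    of the index, with [a] and [b] swapped. *)
Lemma mul_mxfL N a b p (f : nat -> nat -> C) : N = (a * b)%N ->
  mxf p N f *m Lmx R a N
  = mxf p N (fun r c => f r (c %% a * b + c %/ a)%N).
Proof.
move=> Nab; apply/matrixP => r c; rewrite !mxE.
have [a0 b0] : (0 < a /\ 0 < b)%N.
  by apply/andP; rewrite -muln_gt0 -Nab (leq_ltn_trans (leq0n _) (ltn_ord c)).
have cb : (c %/ a < b)%N by rewrite ltn_divLR // mulnC -Nab.
have sN : (c %% a * b + c %/ a < N)%N.
  by rewrite [X in (_ < X)%N]Nab ltn_block ?ltn_mod.
have Nb : (N %/ a = b)%N by rewrite Nab mulKn.
rewrite -(sum_delta (fun l => f r l) sN); apply: eq_bigr => l _.
have la : (l %/ b < a)%N by rewrite ltn_divLR // -Nab.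
rewrite !mxE Nb.
have -> : (c == l %% b * a + l %/ b :> nat)%N = (l == c %% a * b + c %/ a :> nat)%N.
  apply/eqP/eqP => ->.
    by rewrite modn_block // divn_block // -divn_eq.
  by rewrite modn_block // divn_block // -divn_eq.
by case: eqP => _; rewrite ?mulr1 ?mulr0.
Qed.

(** For [N = a b] the permutations [L_b] and [L_a] are inverse to each other. Conjugation turns
    consecutive blocks of length [b] into residue classes modulo [a]. *)
Lemma stride_bdf N a b (G : nat -> nat -> nat -> C) : N = (a * b)%N ->
  Lmx R b N *m (mxf N N (bdf b G) *m Lmx R a N) = mxf N N (cbf a G).
Proof.
move=> Nab; rewrite (mul_mxfL _ _ Nab) (@mul_Lmxf N b a); last by rewrite Nab mulnC.
apply: eq_mxf => r c rN cN.
have [a0 b0] : (0 < a /\ 0 < b)%N.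
  by apply/andP; rewrite -muln_gt0 -Nab (leq_ltn_trans (leq0n _) rN).
have rb : (r %/ a < b)%N by rewrite ltn_divLR // mulnC -Nab.
have cb : (c %/ a < b)%N by rewrite ltn_divLR // mulnC -Nab.
by rewrite /bdf /cbf !divn_block // !modn_block.
Qed.

(** The Kronecker factor fixes the quotient by [a] of the summation index and the strided matrix its
    remainder, so one summand is left. *)
Lemma tens_DFT_cbf N a b (f : nat -> nat -> C) (E : nat -> nat -> nat -> C)
    (e : (b * a = N)%N) :
  Lmx R a N *m castmx (e, e) ((1%:M : 'M_b) *t mxf a a f) *m mxf N N (cbf a E)
  = mxf N N (fun r c => f (r %/ b)%N (c %% a)%N * E (c %% a)%N (r %% b)%N (c %/ a)%N).
Proof.
have Nab : N = (a * b)%N by rewrite -e mulnC.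
rewrite (@tens1_bdf _ _ _ _ a) // castmx_mxf (mul_Lmxf _ _ Nab) mul_mxf.
apply: eq_mxf => r c rN cN.
have [a0 b0] : (0 < a /\ 0 < b)%N.
  by apply/andP; rewrite -muln_gt0 -Nab (leq_ltn_trans (leq0n _) rN).
have rb : (r %/ b < a)%N by rewrite ltn_divLR // -Nab.
have sN : (r %% b * a + c %% a < N)%N.
  by rewrite [X in (_ < X)%N]Nab (mulnC a) ltn_block ?ltn_mod.
pose h l := f (r %/ b)%N (l %% a)%N * E (l %% a)%N (l %/ a)%N (c %/ a)%N.
transitivity (\sum_(l < N) if l == (r %% b * a + c %% a)%N :> nat then h l else 0).
  apply: eq_bigr => l _; rewrite /bdf /cbf divn_block // modn_block //.
  have -> : (l == r %% b * a + c %% a :> nat)%N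
      = (r %% b == l %/ a)%N && (l %% a == c %% a)%N.
    apply/eqP/andP => [->|[/eqP -> /eqP <-]]; last by rewrite -divn_eq.
    by rewrite divn_block ?ltn_mod // modn_block ?ltn_mod // !eqxx.
  case: eqP => _ /=; last by rewrite mul0r.
  by case: eqP => [_|_]; rewrite ?mulr0.
by rewrite sum_delta // /h divn_block ?ltn_mod // modn_block ?ltn_mod.
Qed.

End Stride.

(** * Points of the unit circle and the recombination identities *)

Section Cis.
Variable R : realType.
Local Notation C := R[i].
Local Open Scope complex_scope.
Implicit Types (x y a : R) (n : nat).

Definition cis x : C := cos x +i* sin x.

Lemma cis0 : cis 0 = 1.
Proof. by rewrite /cis cos0 sin0. Qed.

Lemma cisD x y : cis (x + y) = cis x * cis y.
Proof. by rewrite /cis cosD sinD; simpc; rewrite (addrC (sin x * _)). Qed.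

Lemma cisX x n : cis x ^+ n = cis (x * n%:R).
Proof.
elim: n => [|n IHn]; first by rewrite mulr0 cis0.
by rewrite exprSr IHn -cisD -natr1 mulrDr mulr1.
Qed.

Lemma cisNK x : cis (- x) * cis x = 1.
Proof. by rewrite -cisD addNr cis0. Qed.

Lemma cisN x : cis (- x) = (cos x)%:C - 'i * (sin x)%:C.
Proof. by rewrite /cis cosN sinN; simpc. Qed.

Lemma cisE x : cis x = (cos x)%:C + 'i * (sin x)%:C.
Proof. by rewrite /cis; simpc. Qed.

Lemma cosDn2pi x n : cos (x + n%:R * (2 * pi)) = cos x.
Proof.
rewrite (mulr_natl _ 2); elim: n => [|n IHn]; first by rewrite mul0r addr0.
by rewrite -natr1 mulrDl mul1r addrA cosD2pi IHn.
Qed.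

Lemma sinDn2pi x n : sin (x + n%:R * (2 * pi)) = sin x.
Proof.
rewrite (mulr_natl _ 2); elim: n => [|n IHn]; first by rewrite mul0r addr0.
by rewrite -natr1 mulrDl mul1r addrA sinD2pi IHn.
Qed.

Lemma cosBn2pi n x : cos (n%:R * (2 * pi) - x) = cos x.
Proof. by rewrite addrC cosDn2pi cosN. Qed.

Lemma sinBn2pi n x : sin (n%:R * (2 * pi) - x) = - sin x.
Proof. by rewrite addrC sinDn2pi sinN. Qed.

Lemma sin_npi n : sin (n%:R * pi : R) = 0.
Proof.
elim: n => [|n IHn]; first by rewrite mul0r sin0.
by rewrite -natr1 mulrDl mul1r sinDpi IHn oppr0.
Qed.

(** The coefficient [(cis(-a) - cis a)/2] is [-i sin a], whose sine cancels against the scaling. *)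
Lemma cis_dst1 a x : sin a != 0 ->
  (cos x)%:C + (cis (- a) - cis a) / 2 * ((sin a)^-1 * sin x)%:C = cis (- x).
Proof.
move=> sa; rewrite !cisN cisE rmorphM /=.
have {}sa : (sin a)%:C != 0 by rewrite eq_complex /= negb_and sa.
rewrite fmorphV /=; move: sa; set s := (sin a)%:C => sa.
by field.
Qed.

(** Taking [cis(-a)] out of the coefficients leaves [cos a] and [-i sin a]; the scaling cancels the
    cosine and the sine, and [cos x - i sin x = cis(-x)] remains. *)
Lemma cis_dct2 a x : cos a != 0 -> sin a != 0 ->
  (cis (- a) ^+ 2 + 1) / 2 * ((cos a)^-1 * cos x)%:C
  + (cis (- a) ^+ 2 - 1) / 2 * ((sin a)^-1 * sin x)%:C = cis (- (a + x)).
Proof.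
move=> ca sa; rewrite opprD cisD.
have -> : cis (- a) ^+ 2 + 1 = cis (- a) * (2 * (cos a)%:C).
  by rewrite -[X in _ + X](cisNK a) expr2 -mulrDr cisN cisE; congr (_ * _); ring.
have -> : cis (- a) ^+ 2 - 1 = cis (- a) * (- 2 * 'i * (sin a)%:C).
  by rewrite -[X in _ - X](cisNK a) expr2 -mulrBr cisN cisE; congr (_ * _); ring.
rewrite (cisN x) !rmorphM /= !fmorphV /=.
have {}sa : (sin a)%:C != 0 by rewrite eq_complex /= negb_and sa.
have {}ca : (cos a)%:C != 0 by rewrite eq_complex /= negb_and ca.
move: sa ca; set s := (sin a)%:C; set c := (cos a)%:C => sa ca.
by field; rewrite sa ca.
Qed.

Lemma omega_cis n : omega R n = cis (- (2 * pi / n%:R)).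
Proof. by []. Qed.

Lemma omegaX n k : (0 < k)%N -> (0 < n)%N -> omega R (k * n) ^+ k = omega R n.
Proof.
move=> k0 n0; rewrite !omega_cis cisX; congr cis; rewrite natrM.
by field; rewrite !pnatr_eq0 -!lt0n k0 n0.
Qed.

Lemma omegan n : (0 < n)%N -> omega R n ^+ n = 1.
Proof.
move=> n0; rewrite omega_cis cisX mulNr mulfVK ?pnatr_eq0 -?lt0n //.
by rewrite /cis cosN sinN mulr_natl cos2pi sin2pi oppr0.
Qed.
End Cis.

(** * The butterflies, column by column *)

Section Butterfly.
Variable K : pzRingType.
Variable m : nat.
Hypothesis hm : (0 < m)%N.
Local Notation d r p := ((r == p :> nat)%N%:R : K).

(** Position [q] belongs to the cosine of index [q], position [m + q] to the sine. Past [m], column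
    [q] uses the reflected index [2m - q], under which the cosine is even and the sine odd. *)
Definition bfly0 (r q : nat) : K :=
  if q == 0%N then d r 0%N
  else if (q < m)%N then d r q + d r (m + q)%N
  else if q == m then d r m
  else d r (2 * m - q)%N - d r (3 * m - q)%N.

(** Column [q] stands for the half-integer index [q - 1/2]: position [q - 1] belongs to its cosine,
    [m + q - 1] to its sine. Index -1/2 reflects to 1/2, which makes column 0 the difference of
    positions 0 and [m]. *)
Definition bfly1 (r q : nat) : K :=
  if q == 0%N then d r 0%N - d r m
  else if (q <= m)%N then d r q.-1 + d r (m + q.-1)%N
  else d r (2 * m - q)%N - d r (3 * m - q)%N.

Lemma sum_mul_delta N (F : nat -> K) p : (p < N)%N ->
  \sum_(r < N) F r * d r p = F p.
Proof.
move=> pN; rewrite -(sum_delta F pN); apply: eq_bigr => r _.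
by case: eqP; rewrite ?mulr1 ?mulr0.
Qed.

Lemma sum_mul_deltaD N (F : nat -> K) p p' : (p < N)%N -> (p' < N)%N ->
  \sum_(r < N) F r * (d r p + d r p') = F p + F p'.
Proof.
move=> pN p'N; under eq_bigr do rewrite mulrDr.
by rewrite big_split /= !sum_mul_delta.
Qed.

Lemma sum_mul_deltaB N (F : nat -> K) p p' : (p < N)%N -> (p' < N)%N ->
  \sum_(r < N) F r * (d r p - d r p') = F p - F p'.
Proof.
move=> pN p'N; under eq_bigr do rewrite mulrBr.
by rewrite sumrB !sum_mul_delta.
Qed.

Lemma sum_bfly0 (F : nat -> K) q : (q < 2 * m)%N ->
  \sum_(r < 2 * m) F r * bfly0 r q
  = if q == 0%N then F 0%N
    else if (q < m)%N then F q + F (m + q)%N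
    else if q == m then F m
    else F (2 * m - q)%N - F (3 * m - q)%N.
Proof.
move=> q2m; rewrite /bfly0; case: eqP => q0; first by rewrite sum_mul_delta //; lia.
case: ifP => qm; first by rewrite sum_mul_deltaD //; lia.
case: eqP => qm'; first by rewrite sum_mul_delta //; lia.
by rewrite sum_mul_deltaB //; lia.
Qed.

Lemma sum_bfly1 (F : nat -> K) q : (q < 2 * m)%N ->
  \sum_(r < 2 * m) F r * bfly1 r q
  = if q == 0%N then F 0%N - F m
    else if (q <= m)%N then F q.-1 + F (m + q.-1)%N
    else F (2 * m - q)%N - F (3 * m - q)%N.
Proof.
move=> q2m; rewrite /bfly1; case: eqP => q0; first by rewrite sum_mul_deltaB //; lia.
case: ifP => qm; first by rewrite sum_mul_deltaD //; lia.
by rewrite sum_mul_deltaB //; lia.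
Qed.

End Butterfly.

(** * Entries of the two butterfly blocks *)

Section ButterflyMatrices.
Variables (R : realType) (m : nat) (hm : (0 < m)%N).
Local Notation C := R[i].

Lemma oppmxf p q (f : nat -> nat -> C) :
  - mxf p q f = mxf p q (fun i j => - f i j).
Proof. by apply/matrixP => i j; rewrite !mxE. Qed.

Lemma B1_mxf : B1 R m = mxf _ _ (bfly0 C m).
Proof.
rewrite /B1 -[Jmx R _]/(mxf _ _ (fun a l => (l == m.-1.-1 - a)%N%:R)).
rewrite oppmxf !mxf1 !mxf0 !block_mxf; apply: eq_mxf => i j im jm.
rewrite /bfly0.
by repeat case: ifP => ?;
  repeat (case: eqP => ?; rewrite ?subr0 ?sub0r ?addr0 ?add0r ?oppr0 //);
  exfalso; lia.
Qed.
Lemma B2_mxf : B2 R m = mxf _ _ (bfly1 C m).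
Proof.
rewrite /B2 -[Jmx R _]/(mxf _ _ (fun a l => (l == m.-1.-1 - a)%N%:R)).
rewrite !mxf1 !oppmxf !mxf0 !block_mxf; apply: eq_mxf => i j im jm.
rewrite /bfly1.
by repeat case: ifP => ?;
  repeat (case: eqP => ?; rewrite ?subr0 ?sub0r ?addr0 ?add0r ?oppr0 //);
  exfalso; lia.
Qed.

End ButterflyMatrices.

(** * The stages between the stride permutations in block diagonal form *)

Section Entries.
Variables (R : realType) (k m : nat) (hk : (0 < k)%N) (hm : (0 < m)%N).
Local Notation C := R[i].
Local Notation n := (2 * k * m)%N.
Local Open Scope complex_scope.

Lemma n_blocks : n = (k * (2 * m))%N. Proof. by rewrite mulnA (mulnC k). Qed.
Let size_B_row : ((1 + m.-1) + (1 + m.-1) = 2 * m)%N. Proof. by lia. Qed.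
Let size_B_col : ((1 + 1) + (m.-1 + m.-1) = 2 * m)%N. Proof. by lia. Qed.
Let size_type1 : (m.+1 + m.-1 = 2 * m)%N. Proof. by lia. Qed.
Let size_type2 : (m + m = 2 * m)%N. Proof. by lia. Qed.
Let m2_gt0 : (0 < 2 * m)%N. Proof. by rewrite muln_gt0. Qed.

Definition bfly (l : nat) : nat -> nat -> C :=
  if l is _.+1 then bfly1 C m else bfly0 C m.

Lemma Bmx_mxf : Bmx R hk hm = mxf n n (bdf (2 * m) bfly) *m Lmx R k n.
Proof.
rewrite /Bmx (B1_mxf _ hm) (B2_mxf _ hm).
by rewrite (cast_dsum_tens _ _ _ _ m2_gt0 size_B_row size_B_row size_B_row
                           size_B_col).
Qed.

Definition Dcoef (l i : nat) : C :=
  if l is _.+1 then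
    if (i < m)%N then ((cos (i%:R * pi / (2 * m)%:R))^-1)%:C
    else ((sin ((i - m).+1%:R * pi / (2 * m)%:R))^-1)%:C
  else if (i < m.+1)%N then 1 else ((sin ((i - m.+1).+1%:R * pi / m%:R))^-1)%:C.

Lemma Dmx_mxf : Dmx R hk hm =
  mxf n n (bdf (2 * m) (fun l => diagf (Dcoef l))).
Proof.
have dg p (f : nat -> R) : diag_mx (\row_(i < p) ((f i)^-1)%:C)
    = mxf p p (diagf (fun i => ((f i)^-1)%:C)).
  exact: (mxf_diag p (fun i => ((f i)^-1)%:C)).
rewrite /Dmx (dg _ (fun j => sin (j.+1%:R * pi / m%:R))).
rewrite (dg _ (fun j => cos (j%:R * pi / (2 * m)%:R))).
rewrite (dg _ (fun j => sin (j.+1%:R * pi / (2 * m)%:R))).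
rewrite dsum_diagf (mxf1_diagf _ m.+1) dsum_diagf.
rewrite (cast_dsum_tens _ _ _ _ m2_gt0) //.
by apply: eq_mxf => i j _ _; rewrite /bdf; case: eqP => // _; case: (_ %/ _)%N.
Qed.

Definition trig (l i j : nat) : C :=
  if l is _.+1 then
    if (i < m)%N then
      if (j < m)%N then (cos (i%:R * (j%:R + 2^-1) * pi / m%:R))%:C else 0
    else if (j < m)%N then 0
    else (sin ((i - m).+1%:R * ((j - m)%:R + 2^-1) * pi / m%:R))%:C
  else
    if (i < m.+1)%N then
      if (j < m.+1)%N then (cos ((i * j)%:R * pi / m%:R))%:C else 0
    else if (j < m.+1)%N then 0
    else (sin (((i - m.+1).+1 * (j - m.+1).+1)%:R * pi / m%:R))%:C.

Lemma trig_mxf :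
  castmx (size_trig hk hm, size_trig hk hm)
    (DCT1 R m ⊕ DST1 R m ⊕ (1%:M : 'M_k.-1) *t (DCT2 R m ⊕ DST2 R m))
  = mxf n n (bdf (2 * m) trig).
Proof.
rewrite -[DCT1 _ _]/(mxf _ _ (fun i j => (cos ((i * j)%:R * pi / m%:R))%:C)).
rewrite -[DST1 _ _]/(mxf _ _ (fun i j => (sin ((i.+1 * j.+1)%:R * pi / m%:R))%:C)).
rewrite -[DCT2 _ _]/(mxf _ _ (fun i j =>
  (cos (i%:R * (j%:R + 2^-1) * pi / m%:R))%:C)).
rewrite -[DST2 _ _]/(mxf _ _ (fun i j =>
  (sin (i.+1%:R * (j%:R + 2^-1) * pi / m%:R))%:C)).
rewrite !dsum_mxf (cast_dsum_tens _ _ _ _ m2_gt0) //.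
by apply: eq_mxf => i j _ _; rewrite /bdf; case: eqP => // _; case: (_ %/ _)%N.
Qed.

Lemma invmx_Zmx : invmx (Zmx R m) = mxf m m (fun i j => (j == i.+1 %% m)%N%:R).
Proof.
rewrite -[Zmx R m]/(mxf m m (fun a l => ((a : nat) == l.+1 %% m)%N%:R)).
set Z := mxf _ _ _; set Z' := mxf _ _ _.
have ZZ : Z' *m Z = 1%:M.
  rewrite mul_mxf mxf1; apply: eq_mxf => i j im jm.
  rewrite (eq_bigr (fun r : 'I_m =>
      (r == j.+1 %% m :> nat)%N%:R * (r == i.+1 %% m :> nat)%N%:R));
    last by move=> r _; rewrite mulrC.
  rewrite (sum_mul_delta (fun r => (r == j.+1 %% m :> nat)%N%:R)) ?ltn_mod //.
  by rewrite -(addn1 i) -(addn1 j) eqn_modDr !modn_small.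
have Zu : Z \in unitmx by case: (mulmx1_unit ZZ).
by rewrite -[LHS]mul1mx -ZZ mulmxK.
Qed.

(** In block 0 the rotation moves the cosine row of frequency [m] behind the sine rows. The sine row
    of frequency [j < m] then sits at [m + j - 1] for every residue, as it already does in DCT-2 and
    DST-2. *)
Definition shiftf (l i j : nat) : C :=
  if l is _.+1 then (i == j)%:R
  else if (i < m)%N then (i == j)%:R else (j == m + (i - m).+1 %% m)%N%:R.

Lemma shift_mxf :
  castmx (size_shift m hk, size_shift m hk)
    ((1%:M : 'M_m) ⊕ invmx (Zmx R m) ⊕ (1%:M : 'M_(2 * k.-1 * m)))
  = mxf n n (bdf (2 * m) shiftf).
Proof.
(* The large identity is cut into blocks of size 2m, so that this stage is block diagonal like the
   others. *)
rewrite invmx_Zmx (mxf1 _ m) dsum_mxf (mxf1_bdf _ _ (2 * m)).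
rewrite (dsum_bdf _ _ _ _ m2_gt0) // castmx_mxf.
apply: eq_mxf => i j _ _; rewrite /bdf; case: eqP => // _; case: (_ %/ _)%N => //=.
have := ltn_pmod i m2_gt0; have := ltn_pmod j m2_gt0.
move: (i %% _)%N (j %% _)%N => {}i {}j jm im.
case: ltnP => i1; case: ltnP => j1 //.
- by case: eqP => //; lia.
- by case: eqP => // e; have := ltn_pmod (i - m).+1 hm; lia.
by congr (_%:R); apply/eqP/eqP; lia.
Qed.

Definition trig_val (l i q : nat) : R :=
  if l is _.+1 then
    if (i < m)%N then cos (i%:R * pi / (2 * m)%:R * (2 * q%:R - 1))
    else sin ((i - m).+1%:R * pi / (2 * m)%:R * (2 * q%:R - 1))
  else
    if (i < m.+1)%N then cos (i%:R * pi / m%:R * q%:R)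
    else sin ((i - m)%:R * pi / m%:R * q%:R).

(** For [q] past [m] the angle at the reflected index is a multiple of 2 pi minus the wanted one. In
    block 0, columns 0 and [m] take no sine entry, in accordance with the zeros of the sine. *)
Lemma trig_bfly l i q : (i < 2 * m)%N -> (q < 2 * m)%N ->
  \sum_(r < 2 * m) trig l i r * bfly l r q = (trig_val l i q)%:C.
Proof.
move=> im qm; have m0 : m%:R != 0 :> R by rewrite pnatr_eq0 -lt0n.
have m20 : (2 * m)%:R != 0 :> R by rewrite pnatr_eq0 -lt0n.
case: l => [|l].
  rewrite (sum_bfly0 hm) //=.
  case: ltnP => i1 /=.
    case: eqP => [->|q0]; first by rewrite muln0 !(mul0r, mulr0).
    case: ltnP => q1 /=.
      rewrite ifT; last by lia.
      rewrite ifN ?addr0; last by lia.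
      by congr ((cos _)%:C); rewrite natrM; field.
    case: eqP => [->|q2].
      by rewrite ltnSn; congr ((cos _)%:C); rewrite natrM; field.
    rewrite ifT; last by lia.
    rewrite ifN ?subr0; last by lia.
    rewrite -(cosBn2pi i); congr ((cos _)%:C).
    rewrite natrM natrB; last by lia.
    by rewrite natrM; field.
  case: eqP => [->|q0]; first by rewrite mulr0 sin0.
  have ei : ((i - m.+1).+1 = i - m)%N by lia.
  rewrite ei.
  case: ltnP => q1 /=.
    rewrite ifT; last by lia.
    rewrite ifN; last by lia.
    have -> : ((m + q - m.+1).+1 = q)%N by lia.
    by rewrite add0r; congr ((sin _)%:C); rewrite natrM; field.
  case: eqP => [->|q2].
    rewrite ltnSn; have -> : (i - m)%:R * pi / m%:R * m%:R = (i - m)%:R * pi :> R.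
      by field.
    by rewrite sin_npi.
  rewrite ifT; last by lia.
  rewrite ifN; last by lia.
  have -> : ((3 * m - q - m.+1).+1 = 2 * m - q)%N by lia.
  have -> : ((i - m) * (2 * m - q))%:R * pi / m%:R
      = (i - m)%:R * (2 * pi) - (i - m)%:R * pi / m%:R * q%:R :> R.
    rewrite natrM (natrB _ (_ : q <= 2 * m)%N); last by lia.
    by rewrite natrM; field.
  by rewrite sinBn2pi rmorphN sub0r opprK.
rewrite (sum_bfly1 hm) //=.
case: ltnP => i1 /=.
  case: eqP => [->|q0].
    rewrite hm ltnn subr0 mulr0 sub0r mulrN1 cosN; congr ((cos _)%:C).
    by rewrite natrM; field.
  case: (leqP q m) => q1 /=.
    rewrite ifT; last by lia.
    rewrite ifN ?addr0; last by lia.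
    congr ((cos _)%:C); rewrite -[in RHS](prednK (_ : 0 < q)%N) -?natr1; last by lia.
    by rewrite natrM; field.
  rewrite ifT; last by lia.
  rewrite ifN ?subr0; last by lia.
  rewrite -(cosBn2pi i); congr ((cos _)%:C).
  rewrite (natrB _ (_ : q <= 2 * m)%N); last by lia.
  by rewrite natrM; field.
case: eqP => [->|q0].
  rewrite hm ltnn subnn mulr0 !sub0r add0r mulrN1 sinN rmorphN; congr (- (sin _)%:C).
  by rewrite natrM; field.
case: (leqP q m) => q1 /=.
  rewrite ifT; last by lia.
  rewrite ifN ?add0r; last by lia.
  rewrite addKn; congr ((sin _)%:C).
  rewrite -[in RHS](prednK (_ : 0 < q)%N) -?natr1; last by lia.
  by rewrite natrM; field.
rewrite ifT; last by lia.
rewrite ifN ?sub0r; last by lia.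
have -> : (3 * m - q - m = 2 * m - q)%N by lia.
have -> : (i - m).+1%:R * ((2 * m - q)%:R + 2^-1) * pi / m%:R
    = (i - m).+1%:R * (2 * pi)
      - (i - m).+1%:R * pi / (2 * m)%:R * (2 * q%:R - 1) :> R.
  rewrite (natrB _ (_ : q <= 2 * m)%N); last by lia.
  by rewrite natrM; field.
by rewrite sinBn2pi rmorphN opprK.
Qed.

(* Row [i] of block [l] after the butterfly, trigonometric, scaling and shift
   stages; for [l = 0] the shift moves row [m], cos(q pi), to the end. *)
Definition shifted_row (l i q : nat) : C :=
  if l is _.+1 then Dcoef l i * (trig_val l i q)%:C
  else
    let i' := if (i < m)%N then i else (m + (i - m).+1 %% m)%N in
    Dcoef 0 i' * (trig_val 0 i' q)%:C.

Lemma eq_bdf s (F G : nat -> nat -> nat -> C) : (0 < s)%N ->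
  (forall l i j, (i < s)%N -> (j < s)%N -> F l i j = G l i j) ->
  mxf n n (bdf s F) = mxf n n (bdf s G).
Proof.
move=> s0 FG; apply: eq_mxf => i j _ _; rewrite /bdf.
by case: eqP => // _; rewrite FG ?ltn_mod.
Qed.

Lemma shifted_mxf :
  mxf n n (bdf (2 * m) shiftf) *m Dmx R hk hm
  *m mxf n n (bdf (2 * m) trig) *m mxf n n (bdf (2 * m) bfly)
  = mxf n n (bdf (2 * m) shifted_row).
Proof.
rewrite Dmx_mxf -!mulmxA !(mul_bdf _ _ n_blocks); apply: eq_bdf => // l i q im qm.
transitivity (\sum_(r < 2 * m) shiftf l i r * (Dcoef l r * (trig_val l r q)%:C)).
  apply: eq_bigr => r _; congr (_ * _).
  pose h u := Dcoef l r * (trig_val l u q)%:C.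
  rewrite -[RHS]/(h r) -(sum_delta h (ltn_ord r)); apply: eq_bigr => u _.
  rewrite /diagf trig_bfly // eq_sym; case: eqP => // _.
  by rewrite mul0r.
have sel (h : nat -> C) p : (p < 2 * m)%N ->
    \sum_(r < 2 * m) (r == p :> nat)%N%:R * h r = h p.
  move=> pm; rewrite -(sum_delta h pm); apply: eq_bigr => r _.
  by case: eqP; rewrite ?mul1r ?mul0r.
case: l => [|l] /=.
  case: ltnP => i1 /=.
    under eq_bigr do rewrite eq_sym.
    by rewrite (sel (fun r => Dcoef 0 r * (trig_val 0 r q)%:C)).
  rewrite (sel (fun r => Dcoef 0 r * (trig_val 0 r q)%:C)) //.
  by have := ltn_pmod (i - m).+1 hm; lia.
under eq_bigr do rewrite eq_sym.
by rewrite (sel (fun r => Dcoef l.+1 r * (trig_val l.+1 r q)%:C)).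
Qed.
End Entries.

(** * The recombination matrix X, one residue at a time *)

Section XMatrix.
Variables (R : realType) (k m : nat) (hk : (0 < k)%N) (hm : (0 < m)%N).
Local Notation C := R[i].
Local Notation n := (2 * k * m)%N.
Local Notation d r p := ((r == p :> nat)%N%:R : C).

Definition Ccoef (l j : nat) : C :=
  if l == 0%N then 1 else omega R n ^+ (j * l) * (omega R (2 * m) ^+ j + 1) / 2.

Definition Ecoef (l j : nat) : C :=
  if l == 0%N then (omega R (2 * m) ^+ j - omega R (2 * m) ^- j) / 2
  else omega R n ^+ (j * l) * (omega R (2 * m) ^+ j - 1) / 2.

Definition Fcoef (l : nat) : C := if l == 0%N then 1 else - omega R (2 * k) ^+ l.

(** Positions [i] and [m + i - 1] hold the cosine and the sine of frequency [i]. Rows past [m] use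
    the reflected frequency [2m - i]; row [m] reads the last position, which holds cos(q pi) or
    sin((2q-1) pi/2). *)
Definition Xcoef (l i j : nat) : C :=
  if i == 0%N then d j 0%N
  else if (i < m)%N then d j i * Ccoef l i + d j (m + i.-1)%N * Ecoef l i
  else if i == m then d j (2 * m).-1 * Fcoef l
  else d j (2 * m - i)%N * Ccoef l i + d j (3 * m - i).-1 * Ecoef l i.

Lemma mxdiag_cbf t (A : nat -> 'M[C]_k) (a : nat -> nat -> C) :
    (forall j, A j = mxf k k (cbf k (fun l _ _ => a l j))) ->
  \mxdiag_(i < t) A i.+1
  = mxf _ _ (cbf k (fun l i j => if i == j then a l i.+1 else 0)).
Proof.
move=> AE; apply: mxblock_cbf => i j; rewrite conform_mx_id -val_eqE /=.
by case: eqP => _; rewrite ?AE // (mxf0_cbf _ _ _ k).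
Qed.

Lemma antidiag_cbf t s (A : nat -> 'M[C]_k) (a : nat -> nat -> C) :
    (forall j, A j = mxf k k (cbf k (fun l _ _ => a l j))) ->
  antidiagmx t (fun i => A (s + i)%N)
  = mxf _ _ (cbf k (fun l i j => if j == (t - i.+1)%N then a l (s + i)%N else 0)).
Proof.
move=> AE; apply: mxblock_cbf => i j; rewrite -val_eqE /=.
by case: eqP => _; rewrite ?AE // (mxf0_cbf _ _ _ k).
Qed.

Lemma Xmx_cbf : Xmx R k hm = mxf n n (cbf k Xcoef).
Proof.
have CE j : Cblock R k m j = mxf k k (cbf k (fun l _ _ => Ccoef l j)).
  exact: (diag_cbf k (Ccoef ^~ j)).
have EE j : Dblock R k m j = mxf k k (cbf k (fun l _ _ => Ecoef l j)).
  exact: (diag_cbf k (Ecoef ^~ j)).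
have FE : Fblock R k = mxf k k (cbf k (fun l _ _ => Fcoef l)).
  exact: (diag_cbf k Fcoef).
have IE : 1%:M = mxf k k (cbf k (fun _ _ _ => 1 : C)).
  rewrite mxf1_diagf; apply: eq_mxf => i j ik jk.
  by rewrite /diagf /cbf !modn_small.
have sumE : (\sum_(i < m.-1) k = m.-1 * k)%N by rewrite sum_nat_const card_ord.
rewrite /Xmx (mxdiag_cbf _ CE) (mxdiag_cbf _ EE) (antidiag_cbf _ _ CE).
rewrite (antidiag_cbf _ _ EE) FE IE !(mxf0_cbf _ _ _ k).
have e1 : k = (1 * k)%N by rewrite mul1n.
have e2 : (k + \sum_(i < m.-1) k = m * k)%N by rewrite sumE -mulSn prednK.
(* In units of [k], the columns of the right half split after [m - 1], those of the left half and
   the rows of each half after 1. *)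
rewrite !(block_cbf _ _ _ _ _ _ hk e1 e1) (block_cbf _ _ _ _ _ _ hk e1 sumE).
rewrite (block_cbf _ _ _ _ _ _ hk e1 sumE) (block_cbf _ _ _ _ _ _ hk e2 e2).
rewrite castmx_mxf; apply: (@eq_cbf _ _ _ (2 * m) (2 * m)) => //; try by rewrite mulnAC.
move=> l i j lk im jm; rewrite /Xcoef.
have [i0|i0] := posnP i.
  rewrite i0 hm /=.
  by do ! (case: ifP => ?); case: eqP => ?; rewrite //; lia.
rewrite /=.
case: (ltnP i m) => im'.
  have -> : (i < 1)%N = false by lia.
  case: (ltnP j m) => jm'.
    have -> : (j == m + i.-1)%N = false by lia.
    rewrite mul0r addr0 subn1 prednK //.
    have [j0|j0] := posnP j.
      by rewrite j0 /= (negPf (_ : 0 != i)%N) ?mul0r // eq_sym -lt0n.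
    have -> : (j < 1)%N = false by lia.
    have -> : (i.-1 == j - 1)%N = (j == i)%N by lia.
    by case: eqP => _; rewrite ?mul1r ?mul0r.
  have -> : (j == i)%N = false by lia.
  rewrite mul0r add0r subn1 prednK //.
  case: ltnP => j1.
    have -> : (i.-1 == j - m)%N = (j == m + i.-1)%N by lia.
    by case: eqP => _; rewrite ?mul1r ?mul0r.
  have -> : (j == m + i.-1)%N = false by lia.
  by rewrite mul0r.
have -> : (i - m < 1)%N = (i == m) by lia.
case: eqP => im''.
  case: (ltnP j m) => jm'.
    have -> : (j == (2 * m).-1)%N = false by lia.
    by rewrite mul0r; case: ifP.
  have -> : (j - m < m.-1)%N = (j != (2 * m).-1)%N by lia.
  by case: eqP => _ /=; rewrite ?mul1r ?mul0r.
have -> : (m.+1 + (i - m - 1) = i)%N by lia.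
case: (ltnP j m) => jm'.
  have -> : (j == (3 * m - i).-1)%N = false by lia.
  rewrite mul0r addr0; case: ltnP => j0.
    have -> : (j == 2 * m - i)%N = false by lia.
    by rewrite mul0r.
  have -> : (j - 1 == m.-1 - (i - m - 1).+1)%N = (j == 2 * m - i)%N by lia.
  by case: eqP => _; rewrite ?mul1r ?mul0r.
have -> : (j == 2 * m - i)%N = false by lia.
rewrite mul0r add0r; case: ltnP => j0.
  have -> : (j - m == m.-1 - (i - m - 1).+1)%N = (j == (3 * m - i).-1)%N by lia.
  by case: eqP => _; rewrite ?mul1r ?mul0r.
have -> : (j == (3 * m - i).-1)%N = false by lia.
by rewrite mul0r.
Qed.
End XMatrix.

(** * Trigonometric rows recombined into powers of omega *)

Section Row.
Variables (R : realType) (k m : nat) (hk : (0 < k)%N) (hm : (0 < m)%N).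
Local Notation C := R[i].
Local Notation n := (2 * k * m)%N.
Local Open Scope complex_scope.

(** A unit common to all residues: the angles are [2q] times it for [l = 0] and [2q - 1] times it
    for [l > 0]. *)
Let half_angle (i : nat) : R := i%:R * pi / (2 * m)%:R.

Let m0 : m%:R != 0 :> R. Proof. by rewrite pnatr_eq0 -lt0n. Qed.
Let k0 : k%:R != 0 :> R. Proof. by rewrite pnatr_eq0 -lt0n. Qed.

Lemma shifted_row0_cos j q : (j < m)%N ->
  shifted_row R m 0 j q = (cos (half_angle j * 2 * q%:R))%:C.
Proof.
move=> jm; rewrite /shifted_row jm /= ltnW // mul1r; congr ((cos _)%:C).
by rewrite /half_angle natrM; field.
Qed.

Lemma shifted_row0_sin j q : (0 < j < m)%N ->
  shifted_row R m 0 (m + j.-1) q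
  = ((sin (half_angle j * 2))^-1 * sin (half_angle j * 2 * q%:R))%:C.
Proof.
move=> /andP[j0 jm]; rewrite /shifted_row ltnNge leq_addr /= addKn prednK //.
rewrite modn_small // ifN -?leqNgt; last by lia.
rewrite ifN -?leqNgt; last by lia.
rewrite addKn (_ : (m + j - m.+1).+1 = j)%N; last by lia.
rewrite -rmorphM /=; congr (((sin _)^-1 * sin _)%:C);
  by rewrite /half_angle natrM; field.
Qed.

Lemma shifted_row0_last q :
  shifted_row R m 0 (2 * m).-1 q = (cos (q%:R * pi))%:C.
Proof.
rewrite /shifted_row ifN -?leqNgt; last by lia.
rewrite (_ : ((2 * m).-1 - m).+1 = m)%N; last by lia.
rewrite modnn addn0 /= ltnSn mul1r; congr ((cos _)%:C).
by field.
Qed.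

Lemma shifted_rowS_cos l j q : (j < m)%N ->
  shifted_row R m l.+1 j q
  = ((cos (half_angle j))^-1 * cos (half_angle j * (2 * q%:R - 1)))%:C.
Proof. by move=> jm; rewrite /shifted_row /= jm -rmorphM. Qed.

Lemma shifted_rowS_sin l j q : (0 < j)%N ->
  shifted_row R m l.+1 (m + j.-1) q
  = ((sin (half_angle j))^-1 * sin (half_angle j * (2 * q%:R - 1)))%:C.
Proof.
move=> j0; rewrite /shifted_row /= ltnNge leq_addr /= addKn prednK //.
by rewrite -rmorphM.
Qed.

Lemma omega2mX i : omega R (2 * m) ^+ i = cis (- half_angle i) ^+ 2.
Proof.
rewrite omega_cis !cisX; congr cis; rewrite /half_angle natrM.
by field.
Qed.

Lemma omega2mNX i : omega R (2 * m) ^- i = cis (half_angle i * 2).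
Proof.
rewrite omega2mX cisX mulNr.
apply: (@mulrI _ (cis (- (half_angle i * 2)))).
  by apply/unitrPr; exists (cis (half_angle i * 2)); apply: cisNK.
rewrite cisNK divrr //.
by apply/unitrPr; exists (cis (half_angle i * 2)); apply: cisNK.
Qed.

Lemma omega_block i q l : omega R n ^+ (i * (q * k + l))
  = omega R n ^+ (i * l) * cis (- (half_angle i * 2 * q%:R)).
Proof.
rewrite mulnDr exprD mulrC; congr (_ * _).
rewrite omega_cis cisX; congr cis; rewrite /half_angle !natrM.
by field; rewrite m0 k0.
Qed.

Let half_angle_refl i : (i <= 2 * m)%N -> half_angle (2 * m - i) = pi - half_angle i.
Proof. by move=> im; rewrite /half_angle natrB // natrM; field. Qed.

Lemma sin_half_angle_gt0 i : (0 < i < 2 * m)%N -> 0 < sin (half_angle i).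
Proof.
move=> /andP[i0 im]; apply: sin_gt0_pi; rewrite /half_angle.
have m2 : 0 < (2 * m)%:R :> R by rewrite ltr0n muln_gt0.
apply/andP; split; first by rewrite divr_gt0 // mulr_gt0 ?ltr0n ?pi_gt0.
by rewrite ltr_pdivrMr // mulrC ltr_pM2l ?pi_gt0 // ltr_nat.
Qed.

Lemma cos_half_angle_neq0 i : (i < 2 * m)%N -> i != m -> cos (half_angle i) != 0.
Proof.
(* For [i > m] the reflection [2m - i] only changes the sign of the cosine; below [m] the angle
   stays under pi/2. *)
wlog : i / (i < m)%N => [hw im inm|im _ _].
  case: (ltnP i m) => [/hw|mi]; first exact.
  have : cos (half_angle (2 * m - i)) != 0 by apply: hw; lia.
  by rewrite half_angle_refl ?(ltnW im) // addrC cosDpi cosN oppr_eq0.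
apply: lt0r_neq0; apply: cos_gt0_pihalf; rewrite /half_angle.
have m2 : 0 < (2 * m)%:R :> R by rewrite ltr0n muln_gt0.
apply/andP; split.
  rewrite (@lt_le_trans _ _ 0) ?oppr_lt0 ?divr_gt0 ?pi_gt0 //.
  by rewrite divr_ge0 ?mulr_ge0 ?ler0n ?pi_ge0.
rewrite ltr_pdivrMr // (_ : pi / 2 * _ = m%:R * pi); last by rewrite natrM; field.
by rewrite ltr_pM2r ?pi_gt0 // ltr_nat.
Qed.

(** Rows 0 and [m] are read off directly; the rows below and above [m] share one computation, up to
    the reflection of the frequency. *)
Lemma X_shifted_row l i q : (l < k)%N -> (i < 2 * m)%N -> (q < 2 * m)%N ->
  \sum_(s < 2 * m) Xcoef R k m l i s * shifted_row R m l s q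
  = omega R n ^+ (i * (q * k + l)).
Proof.
move=> lk im qm.
have sel p (c : C) : (p < 2 * m)%N ->
    \sum_(s < 2 * m) (s == p :> nat)%N%:R * c * shifted_row R m l s q
    = c * shifted_row R m l p q.
  move=> pm; rewrite -(sum_delta (fun s => c * shifted_row R m l s q) pm).
  by apply: eq_bigr => s _; case: eqP; rewrite ?mul1r ?mul0r.
have [i0|i0] := posnP i.
  rewrite i0 mul0n expr0.
  (* Row 0 has a bare delta; a factor 1 brings it to the shape of [sel]. *)
  under eq_bigr => s _ do rewrite -[X in X * _]mulr1.
  rewrite (sel 0%N 1) ?muln_gt0 // mul1r.
  case: (l) => [|l']; first by rewrite shifted_row0_cos // /half_angle !mul0r cos0.
  by rewrite shifted_rowS_cos // /half_angle !mul0r cos0 invr1 mulr1.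
rewrite omega_block /Xcoef eqn0Ngt i0 /=.
have [->|/eqP inm] := eqVneq i m.
  rewrite ltnn (sel _ (Fcoef R k l)); last by lia.
  have -> : half_angle m * 2 * q%:R = q%:R * pi.
    by rewrite /half_angle natrM; field.
  rewrite cisN sin_npi mulr0 subr0 /Fcoef.
  case: (l) lk => [|l'] lk.
    by rewrite shifted_row0_last eqxx muln0 expr0 mul1r.
  rewrite (_ : (2 * m).-1 = m + m.-1)%N; last by lia.
  rewrite shifted_rowS_sin //= exprM (mulnC (2 * k)%N) omegaX ?muln_gt0 ?hk //.
  have -> : half_angle m = pi / 2 by rewrite /half_angle natrM; field.
  (* The minus sign of [Fcoef] cancels that of [sin(q pi - pi/2) = -cos(q pi)]. *)
  rewrite sin_pihalf invr1 mul1r mulNr -mulrN -rmorphN; congr (_ * _%:C).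
  rewrite (_ : pi / 2 * _ = q%:R * pi - pi / 2); last by field.
  by rewrite sinBpihalf opprK.
have h_gt0 : 0 < sin (half_angle i) by apply: sin_half_angle_gt0; rewrite i0.
have hcos := cos_half_angle_neq0 im (introN eqP inm).
have h2_neq0 : sin (half_angle i * 2) != 0.
  by rewrite mulr_natr sin_mulr2n mulrn_eq0 /= mulf_neq0 // gt_eqF.
(* Here [j] is the frequency that the row reads, [i] or [2m - i]. The equations let the values at
   [j] be replaced by those at [i]; the first two serve [l = 0], the last two [l > 0]. *)
have key j : (0 < j < m)%N ->
    cos (half_angle j * 2 * q%:R) = cos (half_angle i * 2 * q%:R) ->
    (sin (half_angle j * 2))^-1 * sin (half_angle j * 2 * q%:R)
      = (sin (half_angle i * 2))^-1 * sin (half_angle i * 2 * q%:R) ->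
    (cos (half_angle j))^-1 * cos (half_angle j * (2 * q%:R - 1))
      = (cos (half_angle i))^-1 * cos (half_angle i * (2 * q%:R - 1)) ->
    (sin (half_angle j))^-1 * sin (half_angle j * (2 * q%:R - 1))
      = (sin (half_angle i))^-1 * sin (half_angle i * (2 * q%:R - 1)) ->
  \sum_(s < 2 * m) ((s == j :> nat)%N%:R * Ccoef R k m l i
      + (s == m + j.-1 :> nat)%N%:R * Ecoef R k m l i) * shifted_row R m l s q
  = omega R n ^+ (i * l) * cis (- (half_angle i * 2 * q%:R)).
  move=> /andP[j0 jm] e1 e2 e3 e4.
  under eq_bigr do rewrite mulrDl.
  rewrite big_split /= !sel; try lia.
  rewrite /Ccoef /Ecoef; case: (l) lk => [|l'] lk.
    rewrite eqxx shifted_row0_cos // shifted_row0_sin ?j0 // e1 e2 mul1r.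
    by rewrite muln0 expr0 mul1r omega2mNX omega2mX cisX mulNr cis_dst1.
  rewrite shifted_rowS_cos // shifted_rowS_sin //= e3 e4 omega2mX.
  rewrite -!(mulrA (omega _ _ ^+ _)) -mulrDr cis_dct2 //; last by rewrite gt_eqF.
  by congr (_ * cis (- _)); ring.
case: ltnP => im'; first by apply: key; rewrite ?i0.
have -> : ((3 * m - i).-1 = m + (2 * m - i).-1)%N by lia.
have hi : half_angle (2 * m - i) = pi - half_angle i by rewrite half_angle_refl // ltnW.
have e2q : half_angle (2 * m - i) * 2 * q%:R = q%:R * (2 * pi) - half_angle i * 2 * q%:R.
  by rewrite hi; ring.
have e1q : half_angle (2 * m - i) * (2 * q%:R - 1)
    = - (half_angle i * (2 * q%:R - 1) + pi) + q%:R * (2 * pi).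
  by rewrite hi; ring.
rewrite /=.
(* Under the reflection, a value and its scaling factor change sign together or not at all. *)
apply: key; first by lia.
- by rewrite e2q cosBn2pi.
- rewrite e2q sinBn2pi hi.
  rewrite (_ : (pi - _) * 2 = 1%:R * (2 * pi) - half_angle i * 2); last by ring.
  by rewrite sinBn2pi invrN mulrNN.
- by rewrite e1q cosDn2pi cosN cosDpi hi addrC cosDpi cosN invrN mulrNN.
by rewrite e1q sinDn2pi sinN sinDpi opprK hi addrC sinDpi sinN opprK.
Qed.
End Row.

(** * The assembled factorization *)

Section Factorization.
Variables (R : realType) (k m : nat) (hk : (0 < k)%N) (hm : (0 < m)%N).
Local Notation C := R[i].
Local Notation n := (2 * k * m)%N.

Lemma DFT_factorization :
  DFT R n =
        Lmx R k n
        *m castmx (size_tens k m, size_tens k m)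
             ((1%:M : 'M_(2 * m)) *t DFT R k)
        *m Xmx R k hm
        *m Lmx R (2 * m) n
        *m castmx (size_shift m hk, size_shift m hk)
             ((1%:M : 'M_m) ⊕ invmx (Zmx R m) ⊕ (1%:M : 'M_(2 * k.-1 * m)))
        *m Dmx R hk hm
        *m castmx (size_trig hk hm, size_trig hk hm)
             (DCT1 R m ⊕ DST1 R m
              ⊕ (1%:M : 'M_k.-1) *t (DCT2 R m ⊕ DST2 R m))
        *m Bmx R hk hm.
Proof.
have m2_gt0 : (0 < 2 * m)%N by rewrite muln_gt0.
have nE := n_blocks k m.
rewrite trig_mxf (shift_mxf _ hk hm) (Xmx_cbf _ hk hm) Bmx_mxf.
set S := mxf _ _ (bdf _ (shiftf _ _)); set D := Dmx _ _ _.
set T := mxf _ _ (bdf _ (trig _ _)); set B := mxf _ _ (bdf _ (bfly _ _)).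
have SE : S *m (D *m (T *m (B *m Lmx R k n)))
    = mxf n n (bdf (2 * m) (shifted_row R m)) *m Lmx R k n.
  by rewrite !mulmxA shifted_mxf.
(* The permutations [L_2m] and [L_k] around the middle stages conjugate them into the strided form
   of X. *)
rewrite -!mulmxA SE (stride_bdf _ nE) (@mul_cbf _ _ (2 * m)); last by rewrite nE mulnC.
have -> : mxf n n (cbf k (fun l i q => \sum_(r < 2 * m)
      Xcoef R k m l i r * shifted_row R m l r q))
    = mxf n n (cbf k (fun l i q => omega R n ^+ (i * (q * k + l)))).
  apply: (@eq_cbf _ _ _ (2 * m) (2 * m)) => //; try by rewrite mulnAC.
  by move=> l i q lk im qm; exact: X_shifted_row.
rewrite -[DFT R k]/(mxf k k (fun a l => omega R k ^+ (a * l))).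
rewrite mulmxA tens_DFT_cbf -[LHS]/(mxf n n (fun a l => omega R n ^+ (a * l))).
apply: eq_mxf => r c rn cn.
(* With [r = 2m r1 + r0] and [c = k c1 + c0], the exponent is [r c = r0 c + 2m r1 c0 + n r1 c1]. The
   last term drops out, and the second gives a power of [omega R k]. *)
rewrite -divn_eq {1}(divn_eq r (2 * m)) mulnDl exprD; congr (_ * _).
have -> : omega R k = omega R n ^+ (2 * m).
  by rewrite -(omegaX R (_ : 0 < 2 * m)%N hk) // nE mulnC.
rewrite -!exprM {1}(divn_eq c k) mulnDr exprD.
rewrite (_ : r %/ (2 * m) * (2 * m) * (c %/ k * k)
           = n * (r %/ (2 * m) * (c %/ k)))%N; last first.
  by rewrite nE; lia.
rewrite exprM omegan ?expr1n ?mul1r; last by rewrite nE muln_gt0 hk.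
by congr (_ ^+ _); lia.
Qed.

(** * Diagonality and sparsity of the factors *)

Lemma Dmx_is_diag : is_diag_mx (Dmx R hk hm).
Proof.
apply/is_diag_mxP => i j ij; rewrite Dmx_mxf mxE /bdf /diagf.
case: eqP => // ed; case: eqP => // em.
by case/eqP: ij; rewrite (divn_eq i (2 * m)) ed em -divn_eq.
Qed.

(** [a] and [b] give the only columns in which a row can be nonzero; they may coincide. *)
Lemma card_row_le2 p q (A : 'M[C]_(p, q)) f (a b : nat -> nat) : A = mxf p q f ->
    (forall i j, (i < p)%N -> (j < q)%N -> f i j != 0 -> j = a i \/ j = b i) ->
  forall i, (#|[set j | A i j != 0%R]| <= 2)%N.
Proof.
move=> -> fab i; rewrite cardE -(size_map val).
apply: (@uniq_leq_size _ _ [:: a i; b i]).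
  by rewrite map_inj_uniq ?enum_uniq //; exact: val_inj.
move=> _ /mapP[j + ->]; rewrite mem_enum inE mxE => /fab -/(_ (ltn_ord i) (ltn_ord j)).
by rewrite !inE => -[] e; rewrite [val j]e eqxx ?orbT.
Qed.

(** The columnwise definition, solved for the column. *)
Lemma bfly0_support r q : (r < 2 * m)%N -> (q < 2 * m)%N -> bfly0 C m r q != 0 ->
  q = (if (r <= m)%N then r else (r - m)%N)
  \/ q = (if (r <= m)%N then (2 * m - r)%N else (3 * m - r)%N).
Proof.
move=> rm qm; rewrite /bfly0.
case: (q =P 0%N) => q0.
  by case: (r =P 0%N) => [->|_]; rewrite ?eqxx //; left.
case: (ltnP q m) => q1.
  case: (r =P q) => r1; first by case: ifP => ?; lia.
  by case: (r =P (m + q)%N) => r2; [case: ifP => ?; lia | rewrite addr0 eqxx].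
case: (q =P m) => q2.
  by case: (r =P m) => [->|_]; rewrite ?eqxx // leqnn; left.
case: (r =P (2 * m - q)%N) => r1; first by case: ifP => ?; lia.
by case: (r =P (3 * m - q)%N) => r2; [case: ifP => ?; lia | rewrite subr0 eqxx].
Qed.

(** Rows 0 and [m], those with [r %% m = 0], have their second entry in column 0; the reflection
    would give 2m, outside the matrix. *)
Lemma bfly1_support r q : (r < 2 * m)%N -> (q < 2 * m)%N -> bfly1 C m r q != 0 ->
  q = (if (r < m)%N then r.+1 else (r - m).+1)
  \/ q = (if r %% m == 0 then 0 else if (r < m)%N then 2 * m - r else 3 * m - r)%N.
Proof.
move=> rm qm; rewrite /bfly1.
case: (q =P 0%N) => q0.
  case: (r =P 0%N) => [->|r0]; first by rewrite mod0n; right.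
  by case: (r =P m) => [->|r1]; [rewrite modnn; right | rewrite subr0 eqxx].
case: (leqP q m) => q1.
  case: (r =P q.-1) => r0; first by case: ifP => ?; lia.
  case: (r =P (m + q.-1)%N) => r1; last by rewrite addr0 eqxx.
  by case: ifP => ?; lia.
have rmod s : (0 < s < m)%N -> (s %% m == 0)%N = false.
  by move=> /andP[s0 sm]; rewrite modn_small //; lia.
case: (r =P (2 * m - q)%N) => r0; first by rewrite r0 rmod; [case: ifP => ?; lia | lia].
case: (r =P (3 * m - q)%N) => r1; last by rewrite subr0 eqxx.
rewrite r1 (_ : 3 * m - q = m + (2 * m - q))%N; last by lia.
by rewrite modnDl rmod; [case: ifP => ?; lia | lia].
Qed.

Lemma Xcoef_support l i j : (i < 2 * m)%N -> (j < 2 * m)%N -> Xcoef R k m l i j != 0 ->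
  j = (if i == 0 then 0 else if i < m then i
       else if i == m then (2 * m).-1 else 2 * m - i)%N
  \/ j = (if i < m then m + i.-1 else (3 * m - i).-1)%N.
Proof.
move=> im jm; rewrite /Xcoef.
case: (i =P 0%N) => i0.
  by case: (j =P 0%N) => [->|_]; rewrite ?eqxx //; left.
case: (ltnP i m) => i1.
  case: (j =P i) => j1; first by left.
  by case: (j =P (m + i.-1)%N) => j2; [right | rewrite !mul0r addr0 eqxx].
case: (i =P m) => i2.
  by case: (j =P (2 * m).-1) => [->|_]; rewrite ?mul0r ?eqxx //; left.
case: (j =P (2 * m - i)%N) => j1; first by left.
by case: (j =P (3 * m - i).-1) => j2; [right | rewrite !mul0r addr0 eqxx].
Qed.

Lemma Bmx_row_le2 i : (#|[set j | Bmx R hk hm i j != 0%R]| <= 2)%N.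
Proof.
have m2_gt0 : (0 < 2 * m)%N by rewrite muln_gt0.
have nE := n_blocks k m.
have BE := Bmx_mxf R hk hm; rewrite (mul_mxfL _ _ nE) in BE.
pose a0 r := if (r <= m)%N then r else (r - m)%N.
pose b0 r := if (r <= m)%N then (2 * m - r)%N else (3 * m - r)%N.
pose a1 r := if (r < m)%N then r.+1 else (r - m).+1.
pose b1 r := (if r %% m == 0 then 0 else if r < m then 2 * m - r else 3 * m - r)%N.
(* [L_k] on the right moves column [u] of block [l] to column [u k + l]. *)
pose col (u0 u1 : nat -> nat) r :=
  ((if r %/ (2 * m) == 0 then u0 (r %% (2 * m)) else u1 (r %% (2 * m))) * k
   + r %/ (2 * m))%N.
apply: (card_row_le2 (a := col a0 a1) (b := col b0 b1) BE) => r c rn cn.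
have cm : (c %/ k < 2 * m)%N by rewrite ltn_divLR // mulnC -nE.
have rm : (r %% (2 * m) < 2 * m)%N by rewrite ltn_mod.
rewrite /bdf divn_block // modn_block // /col.
case: (r %/ (2 * m) =P c %% k)%N => [->|_]; last by rewrite eqxx.
case: (c %% k)%N (divn_eq c k) => [|l] ce /=.
  by case/(bfly0_support rm cm) => e; [left|right]; rewrite {1}ce e.
by case/(bfly1_support rm cm) => e; [left|right]; rewrite {1}ce e.
Qed.

Lemma Xmx_row_le2 i : (#|[set j | Xmx R k hm i j != 0%R]| <= 2)%N.
Proof.
have XE := Xmx_cbf R hk hm.
pose a i := (if i == 0 then 0 else if i < m then i
             else if i == m then (2 * m).-1 else 2 * m - i)%N.
pose b i := (if i < m then m + i.-1 else (3 * m - i).-1)%N.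
pose col (u : nat -> nat) r := (u (r %/ k) * k + r %% k)%N.
apply: (card_row_le2 (a := col a) (b := col b) XE) => r c rn cn.
have lt_div s : (s < n)%N -> (s %/ k < 2 * m)%N.
  by move=> sn; rewrite ltn_divLR // mulnAC.
rewrite /cbf /col; case: (r %% k =P c %% k)%N => [->|_]; last by rewrite eqxx.
case/(Xcoef_support (lt_div _ rn) (lt_div _ cn)) => e; [left|right];
  by rewrite {1}(divn_eq c k) e.
Qed.

End Factorization.

Theorem theorem6p1 (R : realType) (k m : nat) (hk : (0 < k)%N) (hm : (0 < m)%N) :
  [/\ DFT R (2 * k * m) =
        Lmx R k (2 * k * m)
        *m castmx (size_tens k m, size_tens k m)
             ((1%:M : 'M_(2 * m)) *t DFT R k)
        *m Xmx R k hm
        *m Lmx R (2 * m) (2 * k * m)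
        *m castmx (size_shift m hk, size_shift m hk)
             ((1%:M : 'M_m) ⊕ invmx (Zmx R m) ⊕ (1%:M : 'M_(2 * k.-1 * m)))
        *m Dmx R hk hm
        *m castmx (size_trig hk hm, size_trig hk hm)
             (DCT1 R m ⊕ DST1 R m
              ⊕ (1%:M : 'M_k.-1) *t (DCT2 R m ⊕ DST2 R m))
        *m Bmx R hk hm,
      is_diag_mx (Dmx R hk hm),
      (forall i, (#|[set j | Bmx R hk hm i j != 0%R]| <= 2)%N),
      (forall i, (#|[set j | Xmx R k hm i j != 0%R]| <= 2)%N)
    & transversal_of (2 * k) (tpoly R k m) (Balg R k m)].
Proof.
split; [exact: DFT_factorization | exact: Dmx_is_diag | exact: Bmx_row_le2
  | exact: Xmx_row_le2 | exact: tpoly_transversal].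
Qed.
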